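(* Let $A$ be a finitely axiomatised Friedman-reflexive theory and ${\sf Id}_A$ the identical interpretation of $A$ in itself. Then $\Lambda^{\sf fr}_{{\sf Id}_A}$ contains ${\sf S}4$.
   Context: Theories are first-order theories in finite signature; interpretations may be multi-dimensional and piecewise; $V\rhd W$ means $V$ interprets $W$. A sentence $C$ is an interpreter of finitely axiomatised $D$ over $U$ iff for all $U$-sentences $B$: $(U+B)\rhd D$ iff $U+B\vdash C$; $U$ is Friedman-reflexive iff every finitely axiomatised $D$ has one; ${\sf C}(D)$ denotes a chosen interpreter over $U$ (here $U=A$). For an interpretation $K$ of $U$ in finitely axiomatised $A$ and an $A$-sentence $B$, $\Diamond_{K}B:=({\sf C}(A\wedge B))^K$, $\Box_K:=\neg\Diamond_K\neg$; for $\sigma$ from atoms to $A$-sentences, $\varphi^{(\sigma,K)}$ maps $p\mapsto\sigma(p)$, commutes with Boolean connectives and sends $\Diamond\psi$ to $\Diamond_K\psi^{(\sigma,K)}$; $\Lambda^{\sf fr}_K$ is the set of modal $\varphi$ with $A\vdash\varphi^{(\sigma,K)}$ for all $\sigma$. *)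

(* Defs.v *)
From Stdlib Require List.
From mathcomp Require Import all_boot.
Set Implicit Arguments.
Unset Strict Implicit.
Unset Printing Implicit Defensive.

Record signature := Signature {
  funsym : finType;
  relsym : finType;
  farity : funsym -> nat;
  rarity : relsym -> nat }.

(* Raw de Bruijn syntax; identity is a logical symbol. *)
Inductive term (S : signature) : Type :=
| Var of nat
| App (f : funsym S) of {ffun 'I_(farity f) -> term S}.

Inductive form (S : signature) : Type :=
| Bot
| Eq of term S & term S
| Rel (r : relsym S) of {ffun 'I_(rarity r) -> term S}
| Imp of form S & form S
| All of form S.

Arguments Var {S}.
Arguments App {S}.
Arguments Bot {S}.
Arguments Rel {S}.

Section Syntax.
Variable S : signature.
Implicit Types (t : term S) (p q : form S).

Definition Neg p := Imp p Bot.
Definition Top : form S := Neg Bot.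
Definition And p q := Neg (Imp p (Neg q)).
Definition Or p q := Imp (Neg p) q.
Definition Ex p := Neg (All (Neg p)).

Fixpoint tsubst (s : nat -> term S) t : term S :=
  match t with
  | Var n => s n
  | App f a => App f [ffun i => tsubst s (a i)]
  end.

Definition shift1 n : term S := Var n.+1.

Definition up (s : nat -> term S) n : term S :=
  if n is m.+1 then tsubst shift1 (s m) else Var 0.

Fixpoint subst (s : nat -> term S) p : form S :=
  match p with
  | Bot => Bot
  | Eq t u => Eq (tsubst s t) (tsubst s u)
  | Rel r a => Rel r [ffun i => tsubst s (a i)]
  | Imp p q => Imp (subst s p) (subst s q)
  | All p => All (subst (up s) p)
  end.

Definition inst1 t n : term S := if n is m.+1 then Var m else t.

(* All free variables have an index below [n]. *)
Fixpoint tbounded n t : bool :=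
  match t with
  | Var m => m < n
  | App f a => [forall i, tbounded n (a i)]
  end.

Fixpoint bounded n p : bool :=
  match p with
  | Bot => true
  | Eq t u => tbounded n t && tbounded n u
  | Rel r a => [forall i, tbounded n (a i)]
  | Imp p q => bounded n p && bounded n q
  | All p => bounded n.+1 p
  end.

Definition is_var t := if t is Var _ then true else false.
Definition var_idx t := if t is Var n then n else 0.

(* Classical natural deduction with identity. *)
Inductive prv : seq (form S) -> form S -> Prop :=
| prv_ax G p : List.In p G -> prv G p
| prv_impI G p q : prv (p :: G) q -> prv G (Imp p q)
| prv_impE G p q : prv G (Imp p q) -> prv G p -> prv G q
| prv_raa G p : prv (Neg p :: G) Bot -> prv G p
| prv_allI G p : prv [seq subst shift1 q | q <- G] p -> prv G (All p)
| prv_allE G p t : prv G (All p) -> prv G (subst (inst1 t) p)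
| prv_refl G t : prv G (Eq t t)
| prv_eqE G p t u :
    prv G (Eq t u) -> prv G (subst (inst1 t) p) -> prv G (subst (inst1 u) p).

Record sentence := Sentence {
  sform :> form S;
  sformP : bounded 0 sform }.

Lemma imp_closed (p q : sentence) : bounded 0 (Imp p q).
Proof. by rewrite /= !sformP. Qed.

Definition sbot : sentence := @Sentence Bot isT.
Definition simp (p q : sentence) : sentence := Sentence (imp_closed p q).
Definition sneg (p : sentence) := simp p sbot.
Definition sand (p q : sentence) := sneg (simp p (sneg q)).

End Syntax.

Arguments prv {S}.
Arguments sbot {S}.

Record theory := Theory {
  tsig : signature;
  tax : sentence tsig -> Prop }.

Definition provable (U : theory) (p : sentence (tsig U)) : Prop :=
  exists G : seq (sentence (tsig U)),
    (forall q, List.In q G -> tax q) /\ prv [seq sform q | q <- G] p.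

Arguments provable : clear implicits.

Definition extend (U : theory) (B : sentence (tsig U)) : theory :=
  @Theory (tsig U) (fun q => tax q \/ q = B).

Record fin_theory := FinTheory {
  fsig : signature;
  fax : seq (sentence fsig) }.

Coercion fin_theory_theory (A : fin_theory) : theory :=
  @Theory (fsig A) (fun q => List.In q (fax A)).

Definition fin_axiom (A : fin_theory) : sentence (fsig A) :=
  foldr (@sand _) (sneg sbot) (fax A).

(* A /\ B, as a finitely axiomatised theory *)
Definition fin_and (A : fin_theory) (B : sentence (fsig A)) : fin_theory :=
  FinTheory [:: sand (fin_axiom A) B].

(* Piecewise, multi-dimensional, parameter-free translations of S into T.
   There is a nonempty finite family of pieces; the elements of piece [i] are
   represented by [dim i]-tuples satisfying [dom i].  A symbol is translated
   separately for each assignment of pieces to its arguments.  The variables of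
   each defining formula are the concatenation of the tuples of its arguments;
   for a function symbol, that of the value comes last. *)
Record translation (S T : signature) := Translation {
  npieces : nat;
  piece := 'I_npieces.+1;
  dim : piece -> nat;
  dom : piece -> form T;
  eqt : piece -> piece -> form T;
  relt : forall r : relsym S, {ffun 'I_(rarity r) -> piece} -> form T;
  funt : forall f : funsym S, {ffun 'I_(farity f) -> piece} -> piece -> form T;
  domP : forall i, bounded (dim i) (dom i);
  eqtP : forall i j, bounded (dim i + dim j) (eqt i j);
  reltP : forall (r : relsym S) (k : {ffun 'I_(rarity r) -> piece}),
    bounded (\sum_i dim (k i)) (relt k);
  funtP : forall (f : funsym S) (k : {ffun 'I_(farity f) -> piece}) (j : piece),
    bounded (\sum_i dim (k i) + dim j) (funt k j) }.

Section Translate.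
Variables (S T : signature) (tau : translation S T).

(* A variable of S is rendered by a piece and a tuple of variables of T. *)
Definition block := (piece tau * seq nat)%type.
Definition env := nat -> block.

Definition shift_block d (b : block) : block := (b.1, [seq d + x | x <- b.2]).
Definition shift_env d (e : env) : env := fun n => shift_block d (e n).
Definition env_cons (i : piece tau) (e : env) : env :=
  fun n => if n is m.+1 then shift_block (dim i) (e m) else (i, iota 0 (dim i)).

Definition at_vars (xs : seq nat) (p : form T) : form T :=
  subst (fun n => Var (nth 0 xs n)) p.

Definition dom_at (b : block) := at_vars b.2 (dom b.1).
Definition eq_at (b c : block) := at_vars (b.2 ++ c.2) (eqt b.1 c.1).
Definition args_vars n (z : 'I_n -> block) : seq nat :=
  flatten [seq (z i).2 | i <- enum 'I_n].
Definition rel_at (r : relsym S) (z : 'I_(rarity r) -> block) :=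
  at_vars (args_vars z) (relt [ffun i => (z i).1]).
Definition fun_at (f : funsym S) (z : 'I_(farity f) -> block) (b : block) :=
  at_vars (args_vars z ++ b.2) (funt [ffun i => (z i).1] b.1).

Definition exs d (p : form T) := iter d (@Ex T) p.
Definition alls d (p : form T) := iter d (@All T) p.

(* [n] consecutive blocks of variables for the pieces [k] *)
Definition fresh n (k : {ffun 'I_n -> piece tau}) (i : 'I_n) : block :=
  (k i, iota (\sum_(j < n | j < i) dim (k j)) (dim (k i))).

(* Term unwinding.  Variables are used directly as arguments; if some argument
   is compound, we quantify over values of the arguments,
     \/_k exists z, /\_i (dom (z i) /\ a i = z i) /\ body z,
   where [val i e b] renders "a i = b", and the first argument of [body] is the
   number of new quantifiers above it. *)
Definition with_args n (val : 'I_n -> env -> block -> form T) (e : env)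
    (a : {ffun 'I_n -> term S}) (body : nat -> ('I_n -> block) -> form T) :=
  if [forall i, is_var (a i)] then body 0 (fun i => e (var_idx (a i)))
  else \big[@Or T/Bot]_(k : {ffun 'I_n -> piece tau})
    let d := \sum_i dim (k i) in
    exs d (And
      (\big[@And T/@Top T]_i
         And (dom_at (fresh k i)) (val i (shift_env d e) (fresh k i)))
      (body d (fresh k))).

(* t = b *)
Fixpoint tr_val (t : term S) (e : env) (b : block) {struct t} : form T :=
  match t with
  | Var n => eq_at (e n) b
  | App f a =>
      with_args (fun i => tr_val (a i)) e a
        (fun d z => fun_at z (shift_block d b))
  end.

Definition tr_eq (e : env) (t u : term S) : form T :=
  if u is Var n then tr_val t e (e n)
  else \big[@Or T/Bot]_(i : piece tau)
    let b := (i, iota 0 (dim i)) in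
    let e' := shift_env (dim i) e in
    exs (dim i) (And (dom_at b) (And (tr_val t e' b) (tr_val u e' b))).

Fixpoint tr (e : env) (p : form S) : form T :=
  match p with
  | Bot => Bot
  | Eq t u => tr_eq e t u
  | Rel r a => with_args (fun i => tr_val (a i)) e a (fun _ z => rel_at z)
  | Imp p q => Imp (tr e p) (tr e q)
  | All p =>
      \big[@And T/@Top T]_(i : piece tau)
        alls (dim i)
          (Imp (dom_at (i, iota 0 (dim i))) (tr (env_cons i e) p))
  end.

(* Irrelevant for sentences. *)
Definition env0 : env := fun _ => (ord0, [::]).

Lemma big_and_bounded (I : finType) (F : I -> form T) m :
  (forall i, bounded m (F i)) -> bounded m (\big[@And T/@Top T]_i F i).
Proof. by move=> h; elim/big_rec: _ => //= i x _ ->; rewrite h. Qed.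

Lemma big_or_bounded (I : finType) (F : I -> form T) m :
  (forall i, bounded m (F i)) -> bounded m (\big[@Or T/Bot]_i F i).
Proof. by move=> h; elim/big_rec: _ => //= i x _ ->; rewrite h. Qed.

Lemma tsubst_bounded (s : nat -> term T) n m t :
  (forall i, i < n -> tbounded m (s i)) -> tbounded n t ->
  tbounded m (tsubst s t).
Proof.
move=> hs; move: t; fix IH 1 => -[i|f a] /=; first exact: hs.
by move=> /forallP h; apply/forallP => i; rewrite ffunE; apply: IH.
Qed.

Lemma subst_bounded (p : form T) (s : nat -> term T) n m :
  (forall i, i < n -> tbounded m (s i)) -> bounded n p ->
  bounded m (subst s p).
Proof.
elim: p s n m => [|t u|r a|p IHp q IHq|p IHp] s n m hs //=.
- by case/andP=> ht hu; rewrite !(tsubst_bounded hs).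
- move=> /forallP h; apply/forallP => i.
  by rewrite ffunE; apply: tsubst_bounded (h i).
- by case/andP=> hp hq; rewrite (IHp _ _ _ hs) // (IHq _ _ _ hs).
- apply: IHp => -[|i] //= lt_in.
  by apply: tsubst_bounded (hs _ lt_in) => j.
Qed.

Lemma at_vars_bounded xs p m :
  all (fun x => x < m) xs -> bounded (size xs) p -> bounded m (at_vars xs p).
Proof. by move=> h; apply: subst_bounded => i lt_i; apply: (all_nthP 0 h). Qed.

Lemma exs_bounded d m p : bounded (d + m) p -> bounded m (exs d p).
Proof.
by elim: d m => [|d IHd] m //= h; rewrite andbT IHd // addnS.
Qed.

Lemma alls_bounded d m p : bounded (d + m) p -> bounded m (alls d p).
Proof. by elim: d m => [|d IHd] m //= h; rewrite IHd // addnS. Qed.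

Definition block_ok m (b : block) :=
  (size b.2 == dim b.1) && all (fun x => x < m) b.2.
Definition env_ok n m (e : env) := forall i, i < n -> block_ok m (e i).

Lemma shift_block_ok d m b : block_ok m b -> block_ok (d + m) (shift_block d b).
Proof.
case/andP=> hs h; rewrite /block_ok /= size_map hs all_map.
by apply: sub_all h => x /=; rewrite ltn_add2l.
Qed.

Lemma iota_block_ok i m :
  block_ok (dim i + m) ((i, iota 0 (dim i)) : block).
Proof.
rewrite /block_ok /= size_iota eqxx; apply/allP => x; rewrite mem_iota /=.
by move=> lt_x; apply: ltn_addr.
Qed.

Lemma env_cons_ok n m e i :
  env_ok n m e -> env_ok n.+1 (dim i + m) (env_cons i e).
Proof.
by move=> he [|j] // lt_j; [apply: iota_block_ok | apply/shift_block_ok/he].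
Qed.

Lemma fresh_ok n (k : {ffun 'I_n -> piece tau}) m i :
  block_ok (\sum_j dim (k j) + m) (fresh k i).
Proof.
rewrite /block_ok /= size_iota eqxx; apply/allP => x; rewrite mem_iota.
case/andP=> _ lt_x; apply/ltn_addr/(leq_trans lt_x).
rewrite [leqRHS](bigID (fun j : 'I_n => j < i)) leq_add2l.
by rewrite (bigD1 i) ?ltnn // leq_addr.
Qed.

Lemma args_vars_ok n (z : 'I_n -> block) m :
  (forall i, block_ok m (z i)) ->
  size (args_vars z) = \sum_i dim (z i).1 /\ all (fun x => x < m) (args_vars z).
Proof.
move=> hz; split.
  rewrite size_flatten sumnE !big_map. rewrite -enumT big_enum /=.
  by apply: eq_bigr => i _; case/andP: (hz i) => /eqP.
by apply/allP => x /flattenP[s /mapP[i _ ->]]; case/andP: (hz i) => _ /allP; apply.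
Qed.

Lemma with_args_bounded n val e (a : {ffun 'I_n -> term S}) body N m :
  (forall i m e b, tbounded N (a i) -> env_ok N m e -> block_ok m b ->
     bounded m (val i e b)) ->
  (forall d z, (forall i, block_ok (d + m) (z i)) -> bounded (d + m) (body d z)) ->
  (forall i, tbounded N (a i)) -> env_ok N m e ->
  bounded m (with_args val e a body).
Proof.
move=> hval hbody ha he; rewrite /with_args; case: ifP => [/forallP hv|_].
  rewrite -[m]add0n; apply: hbody => i; apply: he.
  by move: (ha i) (hv i); case: (a i).
apply: big_or_bounded => k; apply: exs_bounded => /=; rewrite !andbT.
rewrite hbody => [|i]; last exact: fresh_ok.
rewrite andbT; apply: big_and_bounded => i /=; rewrite !andbT.
rewrite hval ?fresh_ok // => [|j lt_j]; last exact/shift_block_ok/he.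
rewrite andbT; have /andP[/eqP hs h] := fresh_ok k m i.
by apply: at_vars_bounded; rewrite // hs domP.
Qed.

Lemma eq_at_bounded m b c : block_ok m b -> block_ok m c -> bounded m (eq_at b c).
Proof.
case/andP=> /eqP hb1 hb /andP[/eqP hc1 hc].
by apply: at_vars_bounded; rewrite ?all_cat ?hb // size_cat hb1 hc1 eqtP.
Qed.

Lemma tr_val_bounded t n m e b :
  tbounded n t -> env_ok n m e -> block_ok m b -> bounded m (tr_val t e b).
Proof.
move: t m e b; fix IH 1 => -[i|f a] m e b /= ht he hb.
  exact: eq_at_bounded (he _ ht) hb.
apply: (with_args_bounded (N := n)) he => [i m' e' b'|d z hz|]; first exact: IH.
  have [sz hz'] := args_vars_ok hz.
  have /andP[/eqP sb hb'] := shift_block_ok d hb.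
  apply: at_vars_bounded; rewrite ?all_cat ?hz' // size_cat sz sb.
  have := funtP [ffun i => (z i).1] (shift_block d b).1.
  by under eq_bigr do rewrite ffunE.
exact/forallP.
Qed.

Lemma tr_eq_bounded n m e t u :
  tbounded n t -> tbounded n u -> env_ok n m e -> bounded m (tr_eq e t u).
Proof.
move=> ht hu he; case: u hu => [j lt_j|f a hu] /=.
  exact: (tr_val_bounded ht) (he _ lt_j).
apply: big_or_bounded => i; apply: exs_bounded.
have he' : env_ok n (dim i + m) (shift_env (dim i) e).
  by move=> j lt_j; apply/shift_block_ok/he.
have hb := iota_block_ok i m; have /andP[/eqP sb hb'] := hb.
have h1 := tr_val_bounded ht he' hb; have h2 := tr_val_bounded hu he' hb.
rewrite /= in h2.
by rewrite /= h1 h2 !andbT; apply: at_vars_bounded; rewrite // sb domP.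
Qed.

Lemma tr_bounded p n m e : bounded n p -> env_ok n m e -> bounded m (tr e p).
Proof.
elim: p n m e => [|t u|r a|p IHp q IHq|p IHp] n m e //=.
- by case/andP=> ht hu; apply: tr_eq_bounded ht hu.
- move=> /forallP ha he.
  apply: (with_args_bounded (N := n)) he => // [i m' e' b|d z hz].
    exact: tr_val_bounded.
  have [sz hz'] := args_vars_ok hz.
  apply: at_vars_bounded; rewrite // sz.
  have := reltP [ffun i => (z i).1].
  by under eq_bigr do rewrite ffunE.
- by case/andP=> hp hq he; rewrite (IHp n) // (IHq n).
- move=> hp he; apply: big_and_bounded => i; apply: alls_bounded => /=.
  rewrite (IHp n.+1) ?andbT //; last exact: env_cons_ok.
  have /andP[/eqP sb hb] := iota_block_ok i m.
  by apply: at_vars_bounded; rewrite // sb domP.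
Qed.

End Translate.

Lemma tr_closed (S T : signature) (tau : translation S T) (p : sentence S) :
  bounded 0 (tr (env0 tau) p).
Proof. exact: tr_bounded (sformP p) _. Qed.

Definition tr_sentence (S T : signature) (tau : translation S T)
    (p : sentence S) : sentence T := Sentence (tr_closed tau p).

(* tau carries an interpretation of W in V. *)
Definition is_interpretation (W V : theory) (tau : translation (tsig W) (tsig V)) :=
  forall p : sentence (tsig W), provable W p -> provable V (tr_sentence tau p).

(* V |> W *)
Definition interprets (V W : theory) : Prop :=
  exists tau : translation (tsig W) (tsig V), is_interpretation tau.

(* C is an interpreter of D over U. *)
Definition interpreter (U : theory) (D : fin_theory) (C : sentence (tsig U)) :=
  forall B : sentence (tsig U),
    interprets (extend B) D <-> provable (extend B) C.
Arguments interpreter : clear implicits.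

Definition Friedman_reflexive (U : theory) : Prop :=
  forall D : fin_theory, exists C : sentence (tsig U), interpreter U D C.

(* One piece of dimension 1 with trivial domain; every symbol is rendered by
   itself. *)
Section Identity.
Variable S : signature.

Let one_dim (_ : 'I_1) := 1.
Let id_rel (r : relsym S) (_ : {ffun 'I_(rarity r) -> 'I_1}) : form S :=
  Rel r [ffun i : 'I__ => Var i].
Let id_fun (f : funsym S) (_ : {ffun 'I_(farity f) -> 'I_1}) (_ : 'I_1) : form S :=
  Eq (App f [ffun i : 'I__ => Var i]) (Var (farity f)).

Lemma id_relP (r : relsym S) (k : {ffun 'I_(rarity r) -> 'I_1}) :
  bounded (\sum_i one_dim (k i)) (id_rel k).
Proof.
by apply/forallP => i; rewrite ffunE /= sum_nat_const card_ord muln1.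
Qed.

Lemma id_funP (f : funsym S) (k : {ffun 'I_(farity f) -> 'I_1}) (j : 'I_1) :
  bounded (\sum_i one_dim (k i) + one_dim j) (id_fun k j).
Proof.
rewrite /= sum_nat_const card_ord muln1 addn1 ltnSn andbT.
by apply/forallP => i; rewrite ffunE /= ltnS ltnW.
Qed.

Definition id_translation : translation S S :=
  @Translation S S 0 one_dim (fun _ => @Top S)
    (fun _ _ => Eq (Var 0) (Var 1)) id_rel id_fun
    (fun _ => isT) (fun _ _ => isT) id_relP id_funP.

End Identity.

Inductive modal : Type :=
| MVar of nat
| MBot
| MImp of modal & modal
| MDia of modal.

Definition MNeg p := MImp p MBot.
Definition MBox p := MNeg (MDia (MNeg p)).

(* As the diamond is the primitive modality, K needs the duality axioms. *)
Inductive S4 : modal -> Prop :=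
| S4_k p q : S4 (MImp p (MImp q p))
| S4_s p q r :
    S4 (MImp (MImp p (MImp q r)) (MImp (MImp p q) (MImp p r)))
| S4_dne p : S4 (MImp (MNeg (MNeg p)) p)
| S4_K p q : S4 (MImp (MBox (MImp p q)) (MImp (MBox p) (MBox q)))
| S4_dual1 p : S4 (MImp (MDia p) (MNeg (MBox (MNeg p))))
| S4_dual2 p : S4 (MImp (MNeg (MBox (MNeg p))) (MDia p))
| S4_T p : S4 (MImp (MBox p) p)
| S4_4 p : S4 (MImp (MBox p) (MBox (MBox p)))
| S4_mp p q : S4 (MImp p q) -> S4 p -> S4 q
| S4_nec p : S4 p -> S4 (MBox p).

Section InterpreterLogic.
(* C D is the chosen interpreter of D over U.  An interpretation of U in A enters
   only through its translation K. *)
Variables (U : theory) (A : fin_theory) (C : fin_theory -> sentence (tsig U)).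
Variable K : translation (tsig U) (fsig A).

Definition diamond (B : sentence (fsig A)) : sentence (fsig A) :=
  tr_sentence K (C (fin_and B)).

Fixpoint modal_tr (sigma : nat -> sentence (fsig A)) (p : modal) :
    sentence (fsig A) :=
  match p with
  | MVar n => sigma n
  | MBot => sbot
  | MImp p q => simp (modal_tr sigma p) (modal_tr sigma q)
  | MDia p => diamond (modal_tr sigma p)
  end.

Definition interpreter_logic (p : modal) : Prop :=
  forall sigma : nat -> sentence (fsig A), provable A (modal_tr sigma p).

End InterpreterLogic.

Arguments interpreter_logic : clear implicits.

(* Main.v *)
(** Interpretations are handled semantically.  Relative to a completeness theorem
    for the natural deduction system, a translation [tau] carries an
    interpretation of W in V iff every model M of V satisfies all translations of
    theorems of W; such an M then has an internal model M^tau of W, and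
    truth of [tr tau p] in M is truth of [p] in M^tau.  Composing translations
    amounts to identifying the internal model of M for the composite with an
    internal model of M^tau.

    For the modal axioms, A + X proves [dia E] iff A + X interprets A + E.
    The identity interpretation gives T, composition of interpretations gives 4.
    For K, if A + E proves E1 \/ E2 and [tau] interprets
    A + E in A + [dia E], then [tau] also interprets A + Ei in
    A + [dia E] + Ei^tau, and one of the Ei^tau holds; hence [dia E] implies
    [dia E1] or [dia E2]. *)

Require Import Defs.
From Stdlib Require Import Classical IndefiniteDescription
  FunctionalExtensionality PropExtensionality.
From mathcomp Require Import all_boot.
Set Implicit Arguments.
Unset Strict Implicit.
Unset Printing Implicit Defensive.

(** * Substitution *)

Section Substitution.
Variable S : signature.
Implicit Types (t u : term S) (p q : form S) (s : nat -> term S).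

(** Arguments sit inside a finite function, so induction on terms needs a hypothesis for every value
    of that function. *)
Lemma term_nested_ind (P : term S -> Prop) :
  (forall n, P (Var n)) ->
  (forall (f : funsym S) (a : {ffun 'I_(farity f) -> term S}),
    (forall i, P (a i)) -> P (App f a)) -> forall t, P t.
Proof. by move=> hv ha; fix IH 1 => -[n|f a]; [exact: hv | apply: ha => i]. Qed.

Lemma tsubst_comp s s' t :
  tsubst s (tsubst s' t) = tsubst (fun n => tsubst s (s' n)) t.
Proof.
elim/term_nested_ind: t => //= f a IH.
by congr App; apply/ffunP => i; rewrite !ffunE IH.
Qed.

Lemma tsubst_Var t : tsubst Var t = t.
Proof.
elim/term_nested_ind: t => //= f a IH.
by congr App; apply/ffunP => i; rewrite !ffunE IH.
Qed.

Lemma up_comp s s' :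
  (fun n => tsubst (up s) (up s' n)) = up (fun n => tsubst s (s' n)).
Proof.
by apply: functional_extensionality => -[|n] //=; rewrite !tsubst_comp.
Qed.

Lemma up_Var : up (@Var S) = Var.
Proof. by apply: functional_extensionality => -[]. Qed.

Lemma subst_comp s s' p :
  subst s (subst s' p) = subst (fun n => tsubst s (s' n)) p.
Proof.
elim: p s s' => //= [t u|r a|p IHp q IHq|p IHp] s s'.
- by rewrite !tsubst_comp.
- by congr Rel; apply/ffunP => i; rewrite !ffunE tsubst_comp.
- by rewrite IHp IHq.
- by rewrite IHp up_comp.
Qed.

Lemma subst_Var p : subst Var p = p.
Proof.
elim: p => //= [t u|r a|p -> q ->|p IHp] //.
- by rewrite !tsubst_Var.
- by congr Rel; apply/ffunP => i; rewrite !ffunE tsubst_Var.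
- by rewrite up_Var IHp.
Qed.

Lemma tsubst_bounded_ext n s s' t :
  tbounded n t -> (forall i, i < n -> s i = s' i) -> tsubst s t = tsubst s' t.
Proof.
move=> ht h; elim/term_nested_ind: t ht => /= [m|f a IH]; first exact: h.
move=> /forallP ha.
by congr App; apply/ffunP => i; rewrite !ffunE IH.
Qed.

Lemma subst_bounded_ext n s s' p :
  bounded n p -> (forall i, i < n -> s i = s' i) -> subst s p = subst s' p.
Proof.
elim: p n s s' => //= [t u|r a|p IHp q IHq|p IHp] n s s'.
- by case/andP=> ht hu h; rewrite !(tsubst_bounded_ext _ h).
- move=> /forallP ha h; congr Rel; apply/ffunP => i.
  by rewrite !ffunE (tsubst_bounded_ext (ha i) h).
- by case/andP=> hp hq h; rewrite (IHp _ _ _ hp h) (IHq _ _ _ hq h).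
- by move=> hp h; rewrite (IHp _ _ (up s') hp) // => -[|i] //= /h ->.
Qed.

Lemma tboundedW n m t : n <= m -> tbounded n t -> tbounded m t.
Proof.
move=> le; elim/term_nested_ind: t => /= [k|f a IH]; first by move/leq_trans; apply.
by move/forallP => h; apply/forallP => i; apply: IH.
Qed.

Lemma boundedW n m p : n <= m -> bounded n p -> bounded m p.
Proof.
elim: p n m => //= [t u|r a|p IHp q IHq|p IHp] n m le.
- by case/andP=> ht hu; rewrite !(tboundedW le).
- by move/forallP => h; apply/forallP => i; apply: tboundedW (h i).
- by case/andP=> hp hq; rewrite (IHp n) // (IHq n).
- exact: IHp.
Qed.

Lemma tbounded_ex t : exists n, tbounded n t.
Proof.
elim/term_nested_ind: t => [n|f a IH]; first by exists n.+1 => /=.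
have /functional_choice[g hg] := IH; exists (\max_i g i); apply/forallP => i.
exact: tboundedW (leq_bigmax i) (hg i).
Qed.

Lemma bounded_ex p : exists n, bounded n p.
Proof.
elim: p => /= [|t u|r a|p [n hn] q [m hm]|p [n hn]]; first by exists 0.
- have [[n hn] [m hm]] := (tbounded_ex t, tbounded_ex u).
  exists (maxn n m).
  by rewrite (tboundedW (leq_maxl _ _) hn) (tboundedW (leq_maxr _ _) hm).
- have /functional_choice[g hg] := fun i => tbounded_ex (a i).
  exists (\max_i g i); apply/forallP => i.
  exact: tboundedW (leq_bigmax i) (hg i).
- exists (maxn n m).
  by rewrite (boundedW (leq_maxl _ _) hn) (boundedW (leq_maxr _ _) hm).
- by exists n; apply: boundedW hn.
Qed.

(** * Structural rules of the deduction system: weakening and substitution *)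

Lemma In_map T T' (g : T -> T') x l : List.In x l -> List.In (g x) (map g l).
Proof. by elim: l => //= y l IH [->|/IH]; [left | right]. Qed.

Lemma In_mapP T T' (g : T -> T') y l :
  List.In y (map g l) -> exists2 x, List.In x l & y = g x.
Proof.
elim: l => //= x l IH [<-|/IH[z hz ->]]; first by exists x; [left|].
by exists z; [right|].
Qed.

Lemma prv_weaken G G' p : prv G p -> List.incl G G' -> prv G' p.
Proof.
move=> h; elim: h G' => {G p}.
- by move=> G p h G' hG; apply/prv_ax/hG.
- move=> G p q _ IH G' hG; apply/prv_impI/IH => x /= [->|/hG]; first by left.
  by right.
- by move=> G p q _ IH1 _ IH2 G' hG; apply: prv_impE (IH1 _ hG) (IH2 _ hG).
- move=> G p _ IH G' hG; apply/prv_raa/IH => x /= [->|/hG]; first by left.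
  by right.
- move=> G p _ IH G' hG; apply/prv_allI/IH => x hx.
  by case: (In_mapP hx) => y /hG hy ->; apply: In_map.
- by move=> G p t _ IH G' hG; apply/prv_allE/IH.
- by move=> G t G' _; apply: prv_refl.
- by move=> G p t u _ IH1 _ IH2 G' hG; apply: prv_eqE (IH1 _ hG) (IH2 _ hG).
Qed.

Lemma subst_inst1 s t p :
  subst s (subst (inst1 t) p) = subst (inst1 (tsubst s t)) (subst (up s) p).
Proof.
rewrite !subst_comp; congr (subst _ p); apply: functional_extensionality.
by case=> [|n] //=; rewrite tsubst_comp tsubst_Var.
Qed.

Lemma prv_subst G p s : prv G p -> prv (map (subst s) G) (subst s p).
Proof.
move=> h; elim: h s => {G p}.
- by move=> G p h s; apply/prv_ax/In_map.
- by move=> G p q _ IH s; apply/prv_impI/IH.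
- by move=> G p q _ IH1 _ IH2 s; apply: prv_impE (IH1 s) (IH2 s).
- by move=> G p _ IH s; apply/prv_raa/IH.
(* Under the quantifier the substitution becomes [up s], which commutes with the shift of the
   context. *)
- move=> G p _ IH s; apply: prv_allI; move: (IH (up s)); rewrite -!map_comp.
  rewrite (@eq_map _ _ _ (subst (@shift1 S) \o subst s)) // => q /=.
  by rewrite !subst_comp.
- by move=> G p t _ IH s; rewrite subst_inst1; apply/prv_allE/IH.
- by move=> G t s; apply: prv_refl.
- move=> G p t u _ IH1 _ IH2 s; rewrite subst_inst1.
  by apply: prv_eqE (IH1 s) _; rewrite -subst_inst1.
Qed.

End Substitution.

(** * Semantics *)

Section Semantics.
Variables (S : signature) (D : Type).

(* Equality is interpreted by a congruence, so that neither term models nor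
   internal models have to be quotiented. *)
Record structure := Structure {
  eqS : D -> D -> Prop;
  relS : forall r : relsym S, ('I_(rarity r) -> D) -> Prop;
  funS : forall f : funsym S, ('I_(farity f) -> D) -> D;
  eqS_refl : forall x, eqS x x;
  eqS_sym : forall x y, eqS x y -> eqS y x;
  eqS_trans : forall x y z, eqS x y -> eqS y z -> eqS x z;
  relS_congr : forall r z w, (forall i, eqS (z i) (w i)) ->
    @relS r z -> relS w;
  funS_congr : forall f z w, (forall i, eqS (z i) (w i)) ->
    eqS (@funS f z) (funS w) }.

Variable M : structure.
Implicit Types (e v : nat -> D) (t : term S) (p q : form S).

Definition scons T (d : T) (e : nat -> T) n := if n is m.+1 then e m else d.

Fixpoint teval e t : D :=
  match t with
  | Var n => e n
  | App f a => funS M (fun i => teval e (a i))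
  end.

Fixpoint sat e p : Prop :=
  match p with
  | Bot => False
  | Eq t u => eqS M (teval e t) (teval e u)
  | Rel r a => relS M (fun i => teval e (a i))
  | Imp p q => sat e p -> sat e q
  | All p => forall d, sat (scons d e) p
  end.

Lemma teval_subst e s t : teval e (tsubst s t) = teval (teval e \o s) t.
Proof.
elim/term_nested_ind: t => //= f a IH; congr funS.
by apply: functional_extensionality => i; rewrite ffunE IH.
Qed.

Lemma sat_subst e s p : sat e (subst s p) <-> sat (teval e \o s) p.
Proof.
elim: p e s => //= [t u|r a|p IHp q IHq|p IHp] e s.
- by rewrite !teval_subst.
- suff -> : (fun i => teval e ([ffun j => tsubst s (a j)] i)) =
            (fun i => teval (teval e \o s) (a i)) by [].
  by apply: functional_extensionality => i; rewrite ffunE teval_subst.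
- by rewrite IHp IHq.
- split=> h d; have := h d; rewrite IHp;
  (suff -> : teval (scons d e) \o up s = scons d (teval e \o s) by []);
  by apply: functional_extensionality => -[|n] //=; rewrite teval_subst.
Qed.

Lemma teval_congr e e' t :
  (forall n, eqS M (e n) (e' n)) -> eqS M (teval e t) (teval e' t).
Proof. by move=> h; elim/term_nested_ind: t => //= f a IH; apply: funS_congr. Qed.

Lemma sat_congr e e' p :
  (forall n, eqS M (e n) (e' n)) -> sat e p <-> sat e' p.
Proof.
elim: p e e' => //= [t u|r a|p IHp q IHq|p IHp] e e' h.
- have [ht hu] := (teval_congr t h, teval_congr u h).
  split=> H; first exact: eqS_trans (eqS_sym ht) (eqS_trans H hu).
  exact: eqS_trans ht (eqS_trans H (eqS_sym hu)).
- by split; apply: relS_congr => i; [|apply: eqS_sym]; apply: teval_congr.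
- by rewrite (IHp _ _ h) (IHq _ _ h).
- have E d : sat (scons d e) p <-> sat (scons d e') p.
    by apply: IHp => -[|n] //=; apply: eqS_refl.
  by split=> H d; apply/E.
Qed.

Lemma teval_bounded n e e' t :
  tbounded n t -> (forall i, i < n -> e i = e' i) -> teval e t = teval e' t.
Proof.
move=> ht h; elim/term_nested_ind: t ht => /= [m|f a IH]; first exact: h.
move=> /forallP ha.
by congr funS; apply: functional_extensionality => i; rewrite IH.
Qed.

Lemma sat_bounded n e e' p :
  bounded n p -> (forall i, i < n -> e i = e' i) -> sat e p <-> sat e' p.
Proof.
elim: p n e e' => //= [t u|r a|p IHp q IHq|p IHp] n e e'.
- by case/andP=> ht hu h; rewrite !(teval_bounded _ h).
- move=> /forallP ha h.
  suff -> : (fun i => teval e (a i)) = (fun i => teval e' (a i)) by [].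
  by apply: functional_extensionality => i; rewrite (teval_bounded (ha i) h).
- by case/andP=> hp hq h; rewrite (IHp _ _ _ hp h) (IHq _ _ _ hq h).
- move=> hp h; have E d : sat (scons d e) p <-> sat (scons d e') p.
    by apply: IHp hp _ => -[|i] //= /h.
  by split=> H d; apply/E.
Qed.

Lemma sat_sentence e e' (p : sentence S) : sat e p -> sat e' p.
Proof. by apply (sat_bounded (sformP p)). Qed.

Lemma sat_And e p q : sat e (And p q) <-> sat e p /\ sat e q.
Proof. by rewrite /=; tauto. Qed.

Lemma sat_Or e p q : sat e (Or p q) <-> sat e p \/ sat e q.
Proof. by rewrite /=; tauto. Qed.

Lemma sat_Ex e p : sat e (Ex p) <-> exists d, sat (scons d e) p.
Proof.
split=> /= [h|[d hd] h]; last exact: h hd.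
by apply: NNPP => h'; apply: h => d hd; apply: h'; exists d.
Qed.

Lemma soundness G p : prv G p ->
  forall e, (forall q, List.In q G -> sat e q) -> sat e p.
Proof.
elim=> {G p}.
- by move=> G p h e; apply.
- by move=> G p q _ IH e h /= hp; apply: IH => r [<-|/h].
- by move=> G p q _ IH1 _ IH2 e h; apply: IH1 h (IH2 _ h).
- move=> G p _ IH e h; apply: NNPP => hp.
  by apply: (IH e) => r [<-|/h].
- move=> G p _ IH e h d; apply: IH => r hr; case: (In_mapP hr) => q /h hq ->.
  by rewrite sat_subst.
- move=> G p t _ IH e h; rewrite sat_subst.
  have := IH e h (teval e t); rewrite (_ : scons _ _ = teval e \o inst1 t) //.
  by apply: functional_extensionality => -[].
- by move=> G t e _; apply: eqS_refl.
(* The two instances evaluate [p] in environments that differ only at 0, where the entries are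
   related by [eqS]; hence [sat_congr] applies. *)
- move=> G p t u _ IH1 _ IH2 e h; have := IH2 e h; rewrite !sat_subst.
  rewrite (@sat_congr (teval e \o inst1 u) (teval e \o inst1 t)) // => -[|n] /=.
    exact/eqS_sym/IH1.
  exact: eqS_refl.
Qed.

End Semantics.

(** * Completeness *)

Section Coding.
Variable S : signature.

(** Trees over [nat] form a countable type, so an injective coding enumerates the formulas for the
    Henkin construction. *)
Fixpoint tcode (t : term S) : GenTree.tree nat :=
  match t with
  | Var n => GenTree.Leaf n
  | App f a =>
      GenTree.Node (enum_rank f) [seq tcode (a i) | i <- enum 'I_(farity f)]
  end.

Fixpoint fcode (p : form S) : GenTree.tree nat :=
  match p with
  | Bot => GenTree.Leaf 0
  | Eq t u => GenTree.Node 0 [:: tcode t; tcode u]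
  | Rel r a => GenTree.Node 1 (GenTree.Leaf (nat_of_ord (enum_rank r))
      :: [seq tcode (a i) | i <- enum 'I_(rarity r)])
  | Imp p q => GenTree.Node 2 [:: fcode p; fcode q]
  | All p => GenTree.Node 3 [:: fcode p]
  end.

Lemma tcode_inj : injective tcode.
Proof.
elim/term_nested_ind=> [n|f a IH] [m|g b] //=; first by case=> ->.
(* Equal node labels identify the symbols, hence the arities, before the arguments can be
   compared. *)
case=> /ord_inj/enum_rank_inj fg; case: g / fg b => b /eq_in_map ab.
by congr App; apply/ffunP => i; apply/IH/ab; rewrite mem_enum.
Qed.

Lemma fcode_inj : injective fcode.
Proof.
elim=> [|t u|r a|p IHp q IHq|p IHp] [|t' u'|r' a'|p' q'|p'] //=.
- by case=> /tcode_inj-> /tcode_inj->.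
- case=> /ord_inj/enum_rank_inj fg; case: r' / fg a' => a' /eq_in_map ab.
  by congr Rel; apply/ffunP => i; apply/tcode_inj/ab; rewrite mem_enum.
- by case=> /IHp-> /IHq->.
- by case=> /IHp->.
Qed.

Lemma form_enumerable : exists g : nat -> form S, forall p, exists n, g n = p.
Proof.
(* The coding is inverted by choice; numbers that code no formula are sent to [Bot]. *)
have /functional_choice[g hg] n : exists p : form S,
    forall q, pickle (fcode q) = n -> p = q.
  have [[q hq]|no] := classic (exists q, pickle (fcode q) = n).
    exists q => r hr; apply: fcode_inj; apply: (pcan_inj pickleK).
    by rewrite hq hr.
  by exists Bot => q hq; case: no; exists q.
by exists g => p; exists (pickle (fcode p)); apply: hg.
Qed.

End Coding.

(** * Henkin construction of a term model *)

Section Completeness.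
Variable S : signature.
Implicit Types (t u : term S) (p q : form S) (G : seq (form S)).

Let prv_hyp p G : prv (p :: G) p.
Proof. by apply: prv_ax; left. Qed.

Let prv_wk p q G : prv G q -> prv (p :: G) q.
Proof. by move=> h; apply: prv_weaken h _ => r; right. Qed.

Lemma prv_absurd G p : prv G (Neg p) -> prv G p -> prv G Bot.
Proof. exact: prv_impE. Qed.

Lemma prv_exfalso G p : prv G Bot -> prv G p.
Proof. by move=> h; apply/prv_raa/prv_wk. Qed.

(** The variable [k] occurs neither in the context nor in [All p], so it can serve as
    eigenvariable. *)
Lemma prv_gen G p k :
  (forall q, List.In q G -> bounded k q) -> bounded k (All p) ->
  prv G (subst (inst1 (Var k)) p) -> prv G (All p).
Proof.
move=> hG hp h; apply: prv_allI.
(* This renaming sends the eigenvariable to 0. It undoes the instantiation of [p], and below [k] it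
   agrees with the shift that [prv_allI] requires. *)
pose s n : term S := if n == k then Var 0 else Var n.+1.
have := prv_subst s h.
have -> : subst s (subst (inst1 (Var k)) p) = p.
  rewrite subst_comp -[RHS]subst_Var; apply: (subst_bounded_ext (n := k.+1)) => //.
  by move=> [|i] /= lt_ik; rewrite /s ?eqxx // ltn_eqF.
move=> h'; apply: prv_weaken h' _ => r hr.
case: (In_mapP hr) => q hq ->.
rewrite (subst_bounded_ext (s' := @shift1 S) (hG _ hq)); first exact: In_map.
by move=> i lt_ik; rewrite /s ltn_eqF.
Qed.

Definition consistent G := ~ prv G Bot.

Definition witnessed G p :=
  forall q, p = Neg (All q) -> exists t, List.In (Neg (subst (inst1 t) q)) G.

Lemma contexts_bounded G : exists k, forall q, List.In q G -> bounded k q.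
Proof.
elim: G => [|p G [k hk]]; first by exists 0.
have [n hn] := bounded_ex p; exists (maxn n k) => q /= [<-|/hk].
  exact: boundedW (leq_maxl _ _) hn.
exact: boundedW (leq_maxr _ _).
Qed.

(** Contexts are finite, so a variable above all bounds is always available as a witness, and the
    language need not be extended by constants. *)
Lemma henkin_step G p : consistent G ->
  exists G', [/\ consistent G', List.incl G G' &
    prv G' (Neg p) \/ prv G' p /\ witnessed G' p].
Proof.
move=> cG; have [hp|hp] := classic (prv (p :: G) Bot).
  by exists G; split=> //; left; apply: prv_impI.
have [[q def_p]|nq] := classic (exists q, p = Neg (All q)); last first.
  exists (p :: G); split=> //; first by move=> r; right.
  by right; split=> // q hq; case: nq; exists q.
subst p; have [k hk] := contexts_bounded (All q :: G).
exists (Neg (subst (inst1 (Var k)) q) :: Neg (All q) :: G); split.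
(* If the witness made the context inconsistent, the instance at the fresh [k] would be derivable,
   hence [All q] by generalization, against [Neg (All q)]. *)
- move/prv_raa => h; apply: hp; apply: prv_absurd (prv_hyp _ _) _.
  apply: (prv_gen (k := k)) h; last by apply: hk; left.
  move=> r [<-|hr]; last by apply: hk; right.
  by have := hk (All q) (or_introl erefl) => /= ->.
- by move=> r hr; right; right.
- right; split; first exact/prv_wk.
  by move=> r [<-]; exists (Var k); left.
Qed.

Section TermModel.
Variables (T : form S -> Prop).
Hypothesis T_closed : forall G p,
  (forall q, List.In q G -> T q) -> prv G p -> T p.
Hypothesis T_consistent : ~ T Bot.
Hypothesis T_complete : forall p, T p \/ T (Neg p).
Hypothesis T_witnessed : forall q, T (Neg (All q)) ->
  exists t, T (Neg (subst (inst1 t) q)).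

Let T1 p q : prv [:: p] q -> T p -> T q.
Proof. by move=> h hp; apply: T_closed h => r /= [<-|]. Qed.

Let T2 p q r : prv [:: p; q] r -> T p -> T q -> T r.
Proof. by move=> h hp hq; apply: T_closed h => x /= [<-|[<-|]]. Qed.

Let T_refl t : T (Eq t t).
Proof. by apply: (T_closed (G := [::])) => //; apply: prv_refl. Qed.

Let T_leibniz p t u :
  T (Eq t u) -> T (subst (inst1 t) p) -> T (subst (inst1 u) p).
Proof.
by apply: T2; apply: prv_eqE (prv_hyp _ _) _; apply/prv_wk/prv_hyp.
Qed.

Let shift_inst t u : tsubst (inst1 t) (tsubst (@shift1 S) u) = u.
Proof. by rewrite tsubst_comp tsubst_Var. Qed.

Let T_sym t u : T (Eq t u) -> T (Eq u t).
Proof.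
move=> h; have := T_leibniz (p := Eq (Var 0) (tsubst (@shift1 S) t)) h.
by rewrite /= !shift_inst; apply.
Qed.

Let T_trans t u v : T (Eq t u) -> T (Eq u v) -> T (Eq t v).
Proof.
move=> tu uv; have := T_leibniz (p := Eq (tsubst (@shift1 S) t) (Var 0)) uv.
by rewrite /= !shift_inst; apply.
Qed.

(* The arguments are replaced one at a time; [F'] is [F] under a binder. *)
Let T_args n (F F' : {ffun 'I_n -> term S} -> form S) (z w : 'I_n -> term S) :
  (forall t a, subst (inst1 t) (F' a) = F [ffun i => tsubst (inst1 t) (a i)]) ->
  (forall i, T (Eq (z i) (w i))) -> T (F [ffun i => z i]) -> T (F [ffun i => w i]).
Proof.
move=> FF' zw Fz; pose h j := [ffun i : 'I_n => if i < j then w i else z i].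
have Fh j : j <= n -> T (F (h j)).
  elim: j => [|j IH] lt_jn.
    by rewrite (_ : h 0 = [ffun i => z i]) //; apply/ffunP => i; rewrite !ffunE.
  pose i0 := Ordinal lt_jn.
  (* Position [j] is opened to the variable 0: instantiating it by [z i0] gives [h j], and by [w i0]
     gives [h j.+1]. *)
  pose a := [ffun i => if i == i0 then Var 0 else tsubst (@shift1 S) (h j i)].
  have := T_leibniz (p := F' a) (zw i0); rewrite !FF'.
  rewrite (_ : [ffun i => _] = h j).
    move=> /(_ (IH (ltnW lt_jn))); rewrite (_ : [ffun i => _] = h j.+1) //.
    apply/ffunP => i; rewrite ffunE /a ffunE; case: eqP => [->|/eqP ne].
      by rewrite ffunE /= ltnSn.
    by rewrite shift_inst !ffunE ltnS [in RHS]leq_eqVlt -val_eqE /= in ne *;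
      rewrite (negPf ne).
  apply/ffunP => i; rewrite ffunE /a ffunE; case: eqP => [->|_].
    by rewrite ffunE /= ltnn.
  by rewrite shift_inst.
have := Fh n (leqnn n); rewrite (_ : h n = [ffun i => w i]) //.
by apply/ffunP => i; rewrite !ffunE ltn_ord.
Qed.

Let term_rel (r : relsym S) (z : 'I_(rarity r) -> term S) :=
  T (Rel r [ffun i => z i]).
Let term_fun (f : funsym S) (z : 'I_(farity f) -> term S) :=
  App f [ffun i => z i].

Let term_rel_congr r (z w : 'I_(rarity r) -> term S) :
  (forall i, T (Eq (z i) (w i))) -> term_rel z -> term_rel w.
Proof. by apply: (T_args (F := Rel r) (F' := Rel r)). Qed.

(** The arguments are rewritten on the right of [Eq t (App f a)], starting from reflexivity of
    [t]. *)
Let term_fun_congr f (z w : 'I_(farity f) -> term S) :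
  (forall i, T (Eq (z i) (w i))) -> T (Eq (term_fun z) (term_fun w)).
Proof.
move=> zw; pose t := term_fun z.
apply: (T_args (F := fun a => Eq t (App f a))
  (F' := fun a => Eq (tsubst (@shift1 S) t) (App f a)) _ zw (T_refl t)) => u a.
by rewrite -[in RHS](shift_inst u t).
Qed.

Definition term_model : structure S (term S) :=
  @Structure S (term S) (fun t u => T (Eq t u)) term_rel term_fun
    T_refl T_sym T_trans term_rel_congr term_fun_congr.

(** Environments of the term model are substitutions, so the truth lemma ranges over all of them and
    induction passes under binders. Implication uses that [T] decides every formula, quantification
    that [T] has witnesses. *)
Lemma term_model_sat e p : sat term_model e p <-> T (subst e p).
Proof.
elim: p e => //= [p IHp q IHq|p IHp] e.
- rewrite IHp IHq; split=> [h|h]; last first.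
    by apply: T2 h; apply: prv_impE (prv_hyp _ _) _; apply/prv_wk/prv_hyp.
  have [hp|hp] := T_complete (subst e p).
    by apply: T1 (h hp); apply/prv_impI/prv_wk.
  apply: T1 hp; apply/prv_impI/prv_exfalso.
  by apply: prv_absurd (prv_hyp _ _); apply/prv_wk.
- have scons_inst t : subst (scons t e) p = subst (inst1 t) (subst (up e) p).
    rewrite subst_comp; congr subst; apply: functional_extensionality.
    by case=> //= n; rewrite shift_inst.
  split=> h; last first.
    by move=> t; apply/IHp; rewrite scons_inst; apply: T1 h; apply: prv_allE.
  have [//|/T_witnessed[t]] := T_complete (All (subst (up e) p)).
  rewrite -scons_inst => nt; case: T_consistent.
  apply: (T2 (p := Neg (subst (scons t e) p))) nt (proj1 (IHp _) (h t)).
  by apply: prv_absurd (prv_hyp _ _) _; apply/prv_wk.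
Qed.

End TermModel.

(** If [p] is not derivable, [Neg p :: G] is consistent. Running [henkin_step] along an enumeration
    of the formulas yields a complete witnessed theory, whose term model satisfies [G] and refutes
    [p]. *)
Theorem completeness G p :
  (forall D (M : structure S D) e, (forall q, List.In q G -> sat M e q) ->
     sat M e p) -> prv G p.
Proof.
move=> valid; apply: NNPP => np.
have [g hg] := form_enumerable S.
have c0 : consistent (Neg p :: G) by move/prv_raa.
pose ctx := {G | consistent G}.
pose step (x : nat * ctx) (y : ctx) := List.incl (sval x.2) (sval y) /\
  (prv (sval y) (Neg (g x.1)) \/
   prv (sval y) (g x.1) /\ witnessed (sval y) (g x.1)).
have /functional_choice[next hnext] : forall x, exists y, step x y.
  case=> n [H cH]; have [H' [cH' sub alt]] := henkin_step (g n) cH.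
  by exists (exist _ H' cH').
pose fix chain n : ctx :=
  if n is m.+1 then next (m, chain m) else exist _ _ c0.
have mono n m : n <= m -> List.incl (sval (chain n)) (sval (chain m)).
  elim: m => [|m IH]; first by rewrite leqn0 => /eqP->.
  rewrite leq_eqVlt => /orP[/eqP-> //|/IH h].
  by move=> r /h /(proj1 (hnext (m, chain m))).
(* [T] collects what some stage derives; stages increase, so finitely many members of [T] are
   derivable at a common stage. *)
pose T q := exists n, prv (sval (chain n)) q.
have Tc H q : (forall r, List.In r H -> T r) -> prv H q -> T q.
  elim: H q => [|r H IH] q hH hq; first by exists 0; apply: prv_weaken hq _.
  have [n hn] : T (Imp r q).
    by apply: IH; [move=> x hx; apply: hH; right | apply: prv_impI].
  have [m hm] : T r by apply: hH; left.
  exists (maxn n m); apply: prv_impE.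
    exact: prv_weaken hn (mono _ _ (leq_maxl _ _)).
  exact: prv_weaken hm (mono _ _ (leq_maxr _ _)).
have Tb : ~ T Bot by case=> n; apply: (svalP (chain n)).
have Talt q : T (Neg q) \/ T q /\ forall r, q = Neg (All r) ->
    exists t, T (Neg (subst (inst1 t) r)).
  have [n <-] := hg q; have [_ [h|[h w]]] := hnext (n, chain n).
    by left; exists n.+1.
  right; split; first by exists n.+1.
  by move=> r /w[t ht]; exists t, n.+1; apply: prv_ax.
have Tm q : T q \/ T (Neg q) by case: (Talt q) => [|[]]; auto.
have Tw q : T (Neg (All q)) -> exists t, T (Neg (subst (inst1 t) q)).
  move=> h; have [h'|[_ w]] := Talt (Neg (All q)); last exact: w.
  case: Tb; apply: (Tc [:: Neg (Neg (All q)); Neg (All q)]).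
    by move=> r /= [<-|[<-|]].
  by apply: prv_absurd (prv_hyp _ _) _; apply/prv_wk.
pose M := term_model Tc.
(* The environment [Var] is the identity substitution, so truth there is membership in [T]. *)
have MT q : sat M Var q <-> T q by rewrite -{2}(subst_Var q); apply: term_model_sat.
have Tnp : T (Neg p) by exists 0; apply: prv_ax; left.
have Tp : T p.
  apply/(proj1 (MT p))/valid => q hq; apply/(proj2 (MT q)).
  by exists 0; apply: prv_ax; right.
apply: Tb; apply: (Tc [:: Neg p; p]); first by move=> r /= [<-|[<-|]].
by apply: prv_absurd (prv_hyp _ _) _; apply/prv_wk.
Qed.

End Completeness.

(** * Translations as representations *)

Section Sequences.
Variable D : Type.
Implicit Types (v : nat -> D) (xs : seq D) (ss : seq (seq D)).

Lemma sumn_ord s : sumn s = \sum_(j < size s) nth 0 s j.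
Proof. by rewrite sumnE (big_nth 0) big_mkord. Qed.

Lemma sum_ord_lt n (d : 'I_n -> nat) (i : 'I_n) :
  \sum_(j < n | j < i) d j = sumn (take i [seq d j | j <- enum 'I_n]).
Proof.
set s := [seq _ | _ <- _]; have sz_s : size s = n by rewrite size_map size_enum_ord.
have ds (j : 'I_n) : d j = nth 0 s j.
  by rewrite (nth_map j) ?nth_ord_enum // size_enum_ord.
rewrite sumn_ord size_take sz_s ltn_ord.
under eq_bigr do rewrite ds.
rewrite -(big_ord_widen n (nth 0 s)) ?(ltnW (ltn_ord i)) //.
by apply: eq_bigr => j _; rewrite nth_take.
Qed.

(** This decodes the offsets used by [fresh] and [pieces_env]: the summed sizes of the earlier
    blocks give the position where a block starts. *)
Lemma map_nth_slice d0 ss i : i < size ss ->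
  [seq nth d0 (flatten ss) x |
     x <- iota (sumn (take i (shape ss))) (size (nth [::] ss i))] = nth [::] ss i.
Proof.
move=> lt_i; rewrite map_nth_iota -nth_shape; first by rewrite -nth_reshape flattenK.
rewrite size_flatten -[X in sumn X - _](cat_take_drop i) sumn_cat addKn.
by rewrite (drop_nth 0) ?size_map // leq_addr.
Qed.

Definition catv xs v n := if n < size xs then nth (v 0) xs n else v (n - size xs).

Lemma catv_nil v : catv [::] v = v.
Proof. by apply: functional_extensionality => n; rewrite /catv subn0. Qed.

(** In a run of quantifiers the outermost one binds the highest of the new variables, hence the last
    entry of the tuple; inductions on such runs therefore peel tuples from the right. *)
Lemma catv_rcons xs x v : catv (rcons xs x) v = catv xs (scons x v).
Proof.
apply: functional_extensionality => n; rewrite /catv size_rcons nth_rcons ltnS.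
case: ltngtP => [lt|gt|->] /=; last by rewrite subnn.
  exact: set_nth_default.
by case: n gt => // n; rewrite ltnS => le; rewrite subSS subSn.
Qed.

Lemma map_catv_shift xs v l :
  [seq catv xs v x | x <- [seq size xs + x | x <- l]] = map v l.
Proof.
rewrite -map_comp; apply: eq_map => x /=.
by rewrite /catv ltnNge leq_addr addKn.
Qed.

Lemma map_catv_iota xs v d0 m n : m + n <= size xs ->
  [seq catv xs v x | x <- iota m n] = [seq nth d0 xs x | x <- iota m n].
Proof.
move=> le; apply/eq_in_map => x; rewrite mem_iota => /andP[_ lt_x].
have lt : x < size xs by exact: leq_trans lt_x le.
by rewrite /catv lt; apply: set_nth_default.
Qed.

End Sequences.

Section SatDerived.
Variables (S : signature) (D : Type) (M : structure S D).
Implicit Types (v : nat -> D) (p : form S).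

Lemma sat_exs v d p :
  sat M v (exs d p) <-> exists2 xs, size xs = d & sat M (catv xs v) p.
Proof.
elim: d v => [|d IH] v.
  split=> [h|[[|//] _]]; last by rewrite catv_nil.
  by exists [::]; rewrite ?catv_nil.
rewrite -[exs _ _]/(Ex (exs d p)) sat_Ex; split=> [[x /IH[xs sz h]]|[xs]].
  by exists (rcons xs x); rewrite ?size_rcons ?sz ?catv_rcons.
case/lastP: xs => // xs x; rewrite size_rcons catv_rcons => -[sz] h.
by exists x; apply/IH; exists xs.
Qed.

Lemma sat_alls v d p :
  sat M v (alls d p) <-> forall xs, size xs = d -> sat M (catv xs v) p.
Proof.
elim: d v => [|d IH] v.
  split=> [h [|//] _|/(_ [::] erefl)]; by rewrite catv_nil.
split=> /= [h xs|h x].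
  case/lastP: xs => // xs x; rewrite size_rcons catv_rcons => -[sz].
  by move/IH: (h x); apply.
by apply/IH => xs sz; rewrite -catv_rcons; apply: h; rewrite size_rcons sz.
Qed.

Lemma sat_big_And v (I : finType) (F : I -> form S) :
  sat M v (\big[@And S/@Top S]_i F i) <-> forall i, sat M v (F i).
Proof.
suff E r : sat M v (\big[@And S/@Top S]_(i <- r) F i) <->
    forall i, i \in r -> sat M v (F i).
  by rewrite E; split=> h i; [apply: h; rewrite mem_index_enum | move=> _].
elim: r => [|i r IH]; first by rewrite big_nil; split=> // _ [].
rewrite big_cons sat_And IH; split=> [[hi h] j|h].
  by rewrite inE => /predU1P[->|/h].
by split=> [|j jr]; apply: h; rewrite inE ?eqxx ?jr ?orbT.
Qed.

Lemma sat_big_Or v (I : finType) (F : I -> form S) :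
  sat M v (\big[@Or S/Bot]_i F i) <-> exists i, sat M v (F i).
Proof.
suff E r : sat M v (\big[@Or S/Bot]_(i <- r) F i) <->
    exists2 i, i \in r & sat M v (F i).
  rewrite E; split=> -[i]; first by exists i.
  by exists i; rewrite ?mem_index_enum.
elim: r => [|i r IH]; first by rewrite big_nil; split=> // -[].
rewrite big_cons sat_Or IH; split=> [[hi|[j jr hj]]|[j]].
- by exists i; rewrite ?inE ?eqxx.
- by exists j; rewrite ?inE ?jr ?orbT.
by rewrite inE => /predU1P[->|jr] hj; [left | right; exists j].
Qed.

(** The default [d0] only fills positions past the tuple, which a formula bounded by the length of
    the tuple does not see. *)
Lemma sat_at_vars d0 v xs p : bounded (size xs) p ->
  sat M v (at_vars xs p) <-> sat M (nth d0 (map v xs)) p.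
Proof.
move=> hp; rewrite sat_subst; apply: sat_bounded hp _ => i lt_i /=.
by rewrite (nth_map 0).
Qed.

End SatDerived.

(** * Satisfaction when function symbols and identity are relations *)

Section RelationalSemantics.
Variables (S : signature) (D : Type).

(* Function symbols and identity are arbitrary relations, as in the image of a
   translation. *)
Record rel_structure := RelStructure {
  req : D -> D -> Prop;
  rrel : forall r : relsym S, ('I_(rarity r) -> D) -> Prop;
  rfun : forall f : funsym S, ('I_(farity f) -> D) -> D -> Prop }.

Variable N : rel_structure.

(** The case split of [with_args] is kept, because for an arbitrary relation in place of identity
    the two branches need not agree. *)
Definition rargs n (val : 'I_n -> D -> Prop) (e : nat -> D)
    (a : {ffun 'I_n -> term S}) (body : ('I_n -> D) -> Prop) : Prop :=
  if [forall i, is_var (a i)] then body (fun i => e (var_idx (a i)))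
  else exists2 z, forall i, val i (z i) & body z.

(* The clauses follow [tr_val], [tr_eq] and [tr]. *)
Fixpoint rval (e : nat -> D) (t : term S) (b : D) : Prop :=
  match t with
  | Var n => req N (e n) b
  | App f a => rargs (fun i => rval e (a i)) e a (fun z => rfun N z b)
  end.

Definition reval_eq e (t u : term S) : Prop :=
  if u is Var n then rval e t (e n) else exists2 b, rval e t b & rval e u b.

Fixpoint rsat (e : nat -> D) (p : form S) : Prop :=
  match p with
  | Bot => False
  | Eq t u => reval_eq e t u
  | Rel r a => rargs (fun i => rval e (a i)) e a (fun z => rrel N z)
  | Imp p q => rsat e p -> rsat e q
  | All p => forall d, rsat (scons d e) p
  end.

End RelationalSemantics.

Definition graph S D (M : structure S D) : rel_structure S D :=
  @RelStructure S D (eqS M) (@relS S D M) (fun f z b => eqS M (funS M z) b).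

(** In a genuine structure congruence makes both branches of [rargs] agree: the actual values of the
    arguments are the witnesses, and any other witnesses are equal to them. *)
Lemma rval_graph S D (M : structure S D) e t b :
  rval (graph M) e t b <-> eqS M (teval M e t) b.
Proof.
elim/term_nested_ind: t b => //= f a IH b; rewrite /rargs.
case: ifP => [/forallP hv|_].
  rewrite (_ : (fun i => e _) = fun i => teval M e (a i)) //.
  by apply: functional_extensionality => i; move: (hv i); case: (a i).
split=> [[z hz]|h].
  by apply: eqS_trans; apply: funS_congr => i; apply/IH.
exists (fun i => teval M e (a i)) => // i; apply/IH; exact: eqS_refl.
Qed.

Lemma rsat_graph S D (M : structure S D) e p : rsat (graph M) e p <-> sat M e p.
Proof.
elim: p e => //= [t u|r a|p IHp q IHq|p IHp] e.
- have ex : (exists2 b, rval (graph M) e t b & rval (graph M) e u b) <->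
      eqS M (teval M e t) (teval M e u).
    split=> [[b /rval_graph tb /rval_graph ub]|h].
      exact: eqS_trans tb (eqS_sym ub).
    by exists (teval M e u); apply/rval_graph => //; apply: eqS_refl.
  by case: u ex => // n _; apply: rval_graph.
- rewrite /rargs; case: ifP => [/forallP hv|_].
    rewrite (_ : (fun i => e _) = fun i => teval M e (a i)) //.
    by apply: functional_extensionality => i; move: (hv i); case: (a i).
  split=> [[z hz]|h].
    by apply: relS_congr => i; apply/eqS_sym/rval_graph.
  exists (fun i => teval M e (a i)) => // i; apply/rval_graph; exact: eqS_refl.
- by rewrite IHp IHq.
- by split=> h d; apply/IHp.
Qed.

(** * Truth of a translation as truth in the represented structure *)

Section Representation.
Variables (S T : signature) (tau : translation S T).
Variables (D E : Type) (M : structure T D) (N : rel_structure S E) (d0 : D).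

Local Notation value := (piece tau * seq D)%type.

Definition args_values n (b : 'I_n -> value) : seq D :=
  flatten [seq (b i).2 | i <- enum 'I_n].

(* [rep b x]: the tuple [b.2] of elements of M, seen in the piece [b.1],
   represents the element [x] of N. *)
Record representation (rep : value -> E -> Prop) : Prop := Representation {
  rep_size : forall b x, rep b x -> size b.2 = dim b.1;
  rep_onto : forall x, exists b, rep b x;
  rep_dom : forall b, size b.2 = dim b.1 ->
    sat M (nth d0 b.2) (dom b.1) <-> exists x, rep b x;
  rep_eq : forall b c x y, rep b x -> rep c y ->
    sat M (nth d0 (b.2 ++ c.2)) (eqt b.1 c.1) <-> req N x y;
  rep_rel : forall (r : relsym S) (b : 'I_(rarity r) -> value) z,
    (forall i, rep (b i) (z i)) ->
    sat M (nth d0 (args_values b)) (relt [ffun i => (b i).1]) <-> rrel N z;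
  rep_fun : forall (f : funsym S) (b : 'I_(farity f) -> value) c z y,
    (forall i, rep (b i) (z i)) -> rep c y ->
    sat M (nth d0 (args_values b ++ c.2)) (funt [ffun i => (b i).1] c.1) <->
    rfun N z y }.

Variable rep : value -> E -> Prop.
Hypothesis repP : representation rep.

Definition block_value (v : nat -> D) (b : block tau) : value :=
  (b.1, map v b.2).

Definition env_rep n v (e : env tau) eps :=
  forall i, i < n -> rep (block_value v (e i)) (eps i).

Let size_args n (b : 'I_n -> value) z : (forall i, rep (b i) (z i)) ->
  size (args_values b) = \sum_i dim (b i).1.
Proof.
move=> hb; rewrite size_flatten /shape -map_comp sumnE big_map big_enum /=.
by apply: eq_bigr => i _; rewrite (rep_size repP (hb i)).
Qed.

Lemma block_value_shift xs v b :
  block_value (catv xs v) (shift_block (size xs) b) = block_value v b.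
Proof. by rewrite /block_value /= map_catv_shift. Qed.

Lemma env_rep_shift n xs v e eps :
  env_rep n v e eps -> env_rep n (catv xs v) (shift_env (size xs) e) eps.
Proof. by move=> h i /h; rewrite /shift_env block_value_shift. Qed.

Lemma block_value_iota i xs v : size xs = dim i ->
  block_value (catv xs v) (i, iota 0 (dim i)) = (i, xs).
Proof.
by move=> sz; rewrite /block_value -sz /= (map_catv_iota _ d0) // map_nth_iota0 // take_size.
Qed.

Lemma env_rep_cons n i xs v e eps x : rep (i, xs) x ->
  env_rep n v e eps -> env_rep n.+1 (catv xs v) (env_cons i e) (scons x eps).
Proof.
move=> hx h; have /= sz := rep_size repP hx.
move=> [|j] lt_j /=; first by rewrite block_value_iota.
rewrite -sz; exact: (env_rep_shift xs h lt_j).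
Qed.

Lemma sat_dom_at v b : size b.2 = dim b.1 ->
  sat M v (dom_at b) <-> exists x, rep (block_value v b) x.
Proof.
move=> sz; rewrite /dom_at (sat_at_vars M d0) ?sz ?domP //.
by apply: (rep_dom repP (b := block_value v b)); rewrite size_map.
Qed.

Lemma sat_eq_at v b c x y : rep (block_value v b) x -> rep (block_value v c) y ->
  sat M v (eq_at b c) <-> req N x y.
Proof.
move=> hb hc; rewrite -(rep_eq repP hb hc) /eq_at (sat_at_vars M d0) ?map_cat //.
move: (rep_size repP hb) (rep_size repP hc); rewrite /= !size_map size_cat => -> ->.
exact: eqtP.
Qed.

Let map_args n v (z : 'I_n -> block tau) :
  map v (args_vars z) = args_values (fun i => block_value v (z i)).
Proof. by rewrite map_flatten -map_comp. Qed.

Lemma sat_rel_at v r (b : 'I_(rarity r) -> block tau) z :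
  (forall i, rep (block_value v (b i)) (z i)) -> sat M v (rel_at b) <-> rrel N z.
Proof.
move=> hb; rewrite -(rep_rel repP hb) /rel_at (sat_at_vars M d0) ?map_args //.
rewrite -(size_map v) map_args (size_args hb).
have := reltP [ffun i => (b i).1]; congr bounded; apply: eq_bigr => i _.
by rewrite ffunE.
Qed.

Lemma sat_fun_at v f (b : 'I_(farity f) -> block tau) c z y :
  (forall i, rep (block_value v (b i)) (z i)) -> rep (block_value v c) y ->
  sat M v (fun_at b c) <-> rfun N z y.
Proof.
move=> hb hc; rewrite -(rep_fun repP hb hc) /fun_at (sat_at_vars M d0).
  by rewrite map_cat map_args.
rewrite size_cat -(size_map v) map_args (size_args hb) -(size_map v c.2).
rewrite (rep_size repP hc).
have := funtP [ffun i => (b i).1] c.1; congr bounded; congr (_ + _).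
by apply: eq_bigr => i _; rewrite ffunE.
Qed.

(** The block of argument [i] starts after the tuples of the earlier arguments, so reading it in the
    concatenation recovers the chosen representative. *)
Lemma block_value_fresh n (b : 'I_n -> value) z v k :
  (forall i, rep (b i) (z i)) -> k = [ffun i => (b i).1] ->
  forall i, block_value (catv (args_values b) v) (fresh k i) = b i.
Proof.
move=> hb -> i; have sz j : dim (b j).1 = size (b j).2 by rewrite (rep_size repP (hb j)).
set ss := [seq (b i).2 | i <- enum 'I_n].
have sz_ss : size ss = n by rewrite size_map size_enum_ord.
have ss_i : nth [::] ss i = (b i).2.
  by rewrite (nth_map i) ?nth_ord_enum // size_enum_ord.
rewrite /block_value /fresh ffunE /= [RHS]surjective_pairing; congr pair.
have off : \sum_(j < n | j < i) dim ([ffun i => (b i).1] j) =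
    sumn (take i (shape ss)).
  rewrite sum_ord_lt; congr (sumn (take _ _)); rewrite -[RHS]map_comp.
  by apply: eq_map => j; rewrite ffunE /= sz.
rewrite off sz -ss_i (map_catv_iota _ d0).
  by apply: map_nth_slice; rewrite sz_ss.
rewrite /args_values -/ss size_flatten.
rewrite -[X in _ <= sumn X](cat_take_drop i) sumn_cat leq_add2l.
by rewrite (drop_nth 0) /= ?nth_shape ?leq_addr // size_map sz_ss.
Qed.

(** The evaluation of arguments is left abstract, so that function symbols, inside the induction on
    terms, and relation symbols share this step. *)
Lemma sat_with_args n N0 v e eps (a : {ffun 'I_n -> term S}) val rv body rbody :
  (forall i, tbounded N0 (a i)) -> env_rep N0 v e eps ->
  (forall i v e b x, env_rep N0 v e eps -> rep (block_value v b) x ->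
     sat M v (val i e b) <-> rv i x) ->
  (forall xs b z, (forall i, rep (block_value (catv xs v) (b i)) (z i)) ->
     sat M (catv xs v) (body (size xs) b) <-> rbody z) ->
  sat M v (with_args val e a body) <-> rargs rv eps a rbody.
Proof.
move=> ha he hval hbody; rewrite /with_args /rargs.
case: ifP => [/forallP hv|_].
  have := hbody [::] (fun i => e (var_idx (a i))) (fun i => eps (var_idx (a i))).
  rewrite catv_nil; apply=> i; apply: he.
  by move: (ha i) (hv i); case: (a i).
rewrite sat_big_Or; split=> [[k]|[z hz hb]].
  move=> /sat_exs[xs sz] /sat_And[/sat_big_And hk hb].
  have {}hk i : exists2 x, rep (block_value (catv xs v) (fresh k i)) x & rv i x.
    have /sat_And[] := hk i; rewrite sat_dom_at ?size_iota // => -[x hx].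
    rewrite (hval _ _ _ _ x) //; first by exists x.
    by rewrite -sz; apply: env_rep_shift.
  have /functional_choice[z hz] i : exists x,
      rep (block_value (catv xs v) (fresh k i)) x /\ rv i x.
    by have [x] := hk i; exists x.
  exists z; first by move=> i; case: (hz i).
  by apply/(hbody xs (fresh k)); [move=> i; case: (hz i) | rewrite sz].
(* Conversely, representatives of the values supply both the pieces [k] that select the disjunct and
   the tuple that witnesses its quantifiers. *)
have /functional_choice[b hbz] i : exists b, rep b (z i) by apply: rep_onto.
pose k := [ffun i => (b i).1].
have bk := block_value_fresh v hbz (erefl k).
have sz : size (args_values b) = \sum_i dim (k i).
  by rewrite (size_args hbz); apply: eq_bigr => i _; rewrite ffunE.
exists k; apply/sat_exs; exists (args_values b) => //; apply/sat_And; split.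
  apply/sat_big_And => i; apply/sat_And; split.
    by apply/sat_dom_at; rewrite ?size_iota //; exists (z i); rewrite bk.
  apply/(hval i _ _ _ (z i)); rewrite ?bk // -sz.
  exact: env_rep_shift.
by rewrite -sz; apply: (proj2 (hbody _ _ z _) hb) => i; rewrite bk.
Qed.

Lemma sat_tr_val n v e eps t b x : tbounded n t -> env_rep n v e eps ->
  rep (block_value v b) x -> sat M v (tr_val t e b) <-> rval N eps t x.
Proof.
elim/term_nested_ind: t v e b x => [i|f a IH] v e b x.
  by move=> lt_i he; apply: sat_eq_at; apply: he.
move=> /= /forallP ha he hb.
apply: (sat_with_args ha he) => [i v' e' b' x' he' hb'|xs c z hc].
  exact: IH.
by apply: sat_fun_at hc _; rewrite block_value_shift.
Qed.

Lemma sat_tr_eq n v e eps t u : tbounded n t -> tbounded n u ->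
  env_rep n v e eps -> sat M v (tr_eq e t u) <-> reval_eq N eps t u.
Proof.
move=> ht hu he; case: u hu => [j lt_j|f a hu].
  exact: sat_tr_val ht he (he _ lt_j).
rewrite /tr_eq /reval_eq; set u := App f a; rewrite sat_big_Or.
split=> [[i]|[x tx ux]].
  move=> /sat_exs[xs sz] /sat_And[].
  rewrite sat_dom_at ?size_iota // => -[x hx] /sat_And[].
  have he' := env_rep_shift xs he; rewrite sz in he'.
  by rewrite !(sat_tr_val _ he' hx) // => tx ux; exists x.
have [[i xs] hx] := rep_onto repP x; have /= sz := rep_size repP hx.
exists i; apply/sat_exs; exists xs => //.
have hx' : rep (block_value (catv xs v) (i, iota 0 (dim i))) x.
  by rewrite block_value_iota.
have he' := env_rep_shift xs he; rewrite sz in he'.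
apply/sat_And; split; first by rewrite sat_dom_at ?size_iota //; exists x.
by apply/sat_And; split;
  [apply/(sat_tr_val ht he' hx') | apply/(sat_tr_val hu he' hx')].
Qed.

(** In the quantifier case [rep_onto] shows that piecewise tuples reach every element, and [rep_dom]
    that every tuple in the domain stands for some element. Nothing is assumed of [N] as a
    structure, so this applies before its relations are known to be functional. *)
Theorem sat_tr n v e eps p : bounded n p -> env_rep n v e eps ->
  sat M v (tr e p) <-> rsat N eps p.
Proof.
elim: p n v e eps => [|t u|r a|p IHp q IHq|p IHp] n v e eps //=.
- by case/andP=> ht hu; apply: sat_tr_eq.
- move=> /forallP ha he.
  apply: (sat_with_args ha he) => [i v' e' b' x'|xs c z]; first exact: sat_tr_val.
  exact: sat_rel_at.
- by case/andP=> hp hq he; rewrite (IHp _ _ _ _ hp he) (IHq _ _ _ _ hq he).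
- move=> hp he; rewrite sat_big_And; split=> [h x|h i].
    have [[i xs] hx] := rep_onto repP x; have /= sz := rep_size repP hx.
    move/sat_alls: (h i) => /(_ xs sz) /=.
    rewrite (IHp n.+1 _ _ (scons x eps)) //; last exact: env_rep_cons.
    by apply; apply/sat_dom_at; rewrite ?size_iota ?block_value_iota //; exists x.
  apply/sat_alls => xs sz /=.
  rewrite sat_dom_at ?size_iota ?block_value_iota // => -[x hx].
  by rewrite (IHp n.+1 _ _ (scons x eps)) //; apply: env_rep_cons.
Qed.

Corollary sat_tr_sentence v eps (p : sentence S) :
  sat M v (tr_sentence tau p) <-> rsat N eps p.
Proof. by apply: sat_tr (sformP p) _. Qed.

End Representation.

(** * Identity translation and internal models *)

Lemma id_representation S D (M : structure S D) d0 :
  representation (tau := id_translation S) M (graph M) d0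
    (fun b x => b.2 = [:: x]).
Proof.
(* This reads argument [i] off the flattened one-entry tuples; [s] leaves room for the value of a
   function symbol, which comes last. *)
have args n (b : 'I_n -> 'I_1 * seq D) z (i : nat) s (lt_i : i < n) :
    (forall i, (b i).2 = [:: z i]) ->
    nth d0 (flatten [seq (b i).2 | i <- enum 'I_n] ++ s) i = z (Ordinal lt_i).
  move=> hb; rewrite (eq_map hb).
  rewrite (_ : flatten _ = [seq z i | i <- enum 'I_n]); last first.
    by elim: (enum _) => //= j l ->.
  rewrite nth_cat size_map size_enum_ord lt_i (nth_map (Ordinal lt_i)).
    by rewrite -[X in nth _ _ X]/(val (Ordinal lt_i)) nth_ord_enum.
  by rewrite size_enum_ord.
split.
- by move=> b x ->.
- by move=> x; exists (ord0, [:: x]).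
- case=> i [|x [|]] //= _; split=> // _; first by exists x.
- by move=> b c x y /= -> ->.
- move=> r b z hb /=.
  rewrite (_ : (fun i => teval M _ _) = z) //.
  apply: functional_extensionality => -[i lt_i]; rewrite ffunE /=.
  by rewrite -(cats0 (args_values _)) /args_values (args _ b z).
- move=> f b c z y hb hc /=.
  rewrite (_ : (fun i => teval M _ _) = z).
    rewrite hc nth_cat (_ : size (args_values b) = farity f).
      by rewrite ltnn subnn.
    rewrite size_flatten /shape -map_comp.
    rewrite (eq_map (g := fun _ => 1)); last by move=> i /=; rewrite hb.
    by rewrite sumnE big_map big_enum sum_nat_const card_ord muln1.
  apply: functional_extensionality => -[i lt_i]; rewrite ffunE /=.
  by rewrite /args_values (args _ b z).
Qed.

Lemma sat_id_translation S D (M : structure S D) e (p : sentence S) :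
  sat M e (tr_sentence (id_translation S) p) <-> sat M e p.
Proof.
by rewrite (sat_tr_sentence (id_representation M (e 0)) e e) rsat_graph.
Qed.

(** A valid sentence whose translation forces the internal domain to be inhabited. *)
Definition nonempty S : sentence S := @Sentence S (Neg (All Bot)) isT.

Section InternalModel.
Variables (S T : signature) (tau : translation S T) (D : Type).
Variables (M : structure T D) (d0 : D).

Definition internal_elt := {b : piece tau * seq D |
  size b.2 = dim b.1 /\ sat M (nth d0 b.2) (dom b.1)}.

(** No quotient is taken: the elements are the representing tuples with their pieces, and [eqt]
    serves as identity. *)
Definition internal : rel_structure S internal_elt := @RelStructure S internal_elt
  (fun x y => sat M (nth d0 ((sval x).2 ++ (sval y).2)) (eqt (sval x).1 (sval y).1))
  (fun r z => sat M (nth d0 (args_values (fun i => sval (z i))))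
     (relt [ffun i => (sval (z i)).1]))
  (fun f z y => sat M (nth d0 (args_values (fun i => sval (z i)) ++ (sval y).2))
     (funt [ffun i => (sval (z i)).1] (sval y).1)).

Lemma internal_representation :
  representation M internal d0 (fun b x => b = sval x).
Proof.
split.
- by move=> b [c [sz _]] /= ->.
- by move=> x; exists (sval x).
- move=> b sz; split=> [h|[[c [_ h]] ->] //].
  by exists (exist _ b (conj sz h)).
- by move=> b c x y -> ->.
- by move=> r b z /functional_extensionality->.
- by move=> f b c z y /functional_extensionality-> ->.
Qed.

Lemma internal_inhabited v :
  sat M v (tr_sentence tau (nonempty S)) -> inhabited internal_elt.
Proof.
rewrite /= sat_big_And => h.
apply: NNPP => no; apply: h => i; apply/sat_alls => xs sz /=.
rewrite (sat_dom_at internal_representation) ?size_iota // => -[x _].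
by case: no; exists.
Qed.

End InternalModel.

Definition valid S (p : form S) : Prop :=
  forall D (M : structure S D) e, sat M e p.

(** * Relational structures satisfying all validities are graphs of structures *)

Section Functional.
Variables (S : signature) (E : Type) (N : rel_structure S E) (x0 : E).
Hypothesis rsat_valid : forall p, valid p -> forall eps, rsat N eps p.

Definition fcat k (z : 'I_k -> E) (tl : nat -> E) n :=
  if insub n is Some i then z i else tl (n - k).

Lemma fcat_ord k (z : 'I_k -> E) tl (i : 'I_k) : fcat z tl i = z i.
Proof. by rewrite /fcat valK. Qed.

Lemma fcat_addn k (z : 'I_k -> E) tl n : fcat z tl (k + n) = tl n.
Proof. by rewrite /fcat insubF ?addKn // ltnNge leq_addr. Qed.

Definition vars k m : {ffun 'I_k -> term S} :=
  [ffun i : 'I_k => Var (m + i)].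

Lemma rargs_vars k m (val : 'I_k -> E -> Prop) eps body :
  rargs val eps (vars k m) body = body (fun i : 'I_k => eps (m + i)) :> Prop.
Proof.
rewrite /rargs ifT; last by apply/forallP => i; rewrite ffunE.
by congr body; apply: functional_extensionality => i; rewrite ffunE.
Qed.

Lemma sat_foldr_Imp D (M : structure S D) e I (F : I -> form S) s c :
  sat M e (foldr (@Imp S) c (map F s)) <->
  ((forall i, List.In i s -> sat M e (F i)) -> sat M e c).
Proof.
elim: s => [|i s IH] /=; first by split=> // h; apply: h.
rewrite IH; split=> [h H|h Hi H]; first by apply: h => [|j hj]; apply: H; auto.
by apply: h => j [<-|/H].
Qed.

Lemma rsat_foldr_Imp eps I (F : I -> form S) s c :
  rsat N eps (foldr (@Imp S) c (map F s)) -> (forall i, rsat N eps (F i)) ->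
  rsat N eps c.
Proof. by elim: s => //= i s IH h H; apply: IH (h (H i)) H. Qed.

Definition eq_vars k c : form S :=
  foldr (@Imp S) c [seq Eq (Var (nat_of_ord i)) (Var (k + i)) | i <- enum 'I_k].

Lemma valid_eq_vars k c :
  (forall D (M : structure S D) (e : nat -> D),
    (forall i : 'I_k, eqS M (e i) (e (k + i))) -> sat M e c) -> valid (eq_vars k c).
Proof.
move=> h D M e; apply/sat_foldr_Imp => H; apply: h => i.
have : i \in enum 'I_k by rewrite mem_enum.
elim: (enum _) H => //= j s IH H; rewrite inE => /predU1P[->|].
  by apply: (H j); left.
by apply: IH => l hl; apply: H; right.
Qed.

Lemma rsat_eq_vars k c (z w : 'I_k -> E) tl : valid (eq_vars k c) ->
  (forall i, req N (z i) (w i)) -> rsat N (fcat z (fcat w tl)) c.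
Proof.
move=> hv zw; apply: rsat_foldr_Imp (rsat_valid hv _) _ => i /=.
by rewrite fcat_addn !fcat_ord.
Qed.

Let fcat0 k (z : 'I_k -> E) tl : (fun i : 'I_k => fcat z tl (0 + i)) = z.
Proof. by apply: functional_extensionality => i; rewrite add0n fcat_ord. Qed.

Let fcatk k (z w : 'I_k -> E) tl :
  (fun i : 'I_k => fcat z (fcat w tl) (k + i)) = w.
Proof. by apply: functional_extensionality => i; rewrite fcat_addn fcat_ord. Qed.

Let tl0 : nat -> E := fun=> x0.

Let refl x : req N x x.
Proof.
apply: (rsat_valid (p := Eq (Var 0) (Var 0)) _ (fun=> x)) => D M e.
exact: eqS_refl.
Qed.

Let sym x y : req N x y -> req N y x.
Proof.
apply: (rsat_valid (p := Imp (Eq (Var 0) (Var 1)) (Eq (Var 1) (Var 0))) _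
  (scons x (scons y tl0))) => D M e; exact: eqS_sym.
Qed.

Let trans x y z : req N x y -> req N y z -> req N x z.
Proof.
apply: (rsat_valid (p := Imp (Eq (Var 0) (Var 1))
  (Imp (Eq (Var 1) (Var 2)) (Eq (Var 0) (Var 2)))) _
  (scons x (scons y (scons z tl0)))) => D M e; exact: eqS_trans.
Qed.

Let rel_congr r (z w : 'I_(rarity r) -> E) :
  (forall i, req N (z i) (w i)) -> rrel N z -> rrel N w.
Proof.
have hv : valid (eq_vars (rarity r)
    (Imp (Rel r (vars (rarity r) 0)) (Rel r (vars (rarity r) (rarity r))))).
  by apply: valid_eq_vars => D M e h /=; apply: relS_congr => i; rewrite !ffunE; apply: h.
by move/(rsat_eq_vars tl0 hv); rewrite /= !rargs_vars fcat0 fcatk.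
Qed.

Let fun_congr f (z w : 'I_(farity f) -> E) y :
  (forall i, req N (z i) (w i)) -> rfun N z y -> rfun N w y.
Proof.
set k := farity f.
have hv : valid (eq_vars k (Imp (Eq (App f (vars k 0)) (Var (k + (k + 0))))
    (Eq (App f (vars k k)) (Var (k + (k + 0)))))).
  apply: valid_eq_vars => D M e h /=; apply: eqS_trans; apply: funS_congr => i.
  by rewrite !ffunE; apply/eqS_sym/h.
move/(rsat_eq_vars (scons y tl0) hv).
by rewrite /= !rargs_vars fcat0 fcatk !fcat_addn.
Qed.

Let fun_total f (z : 'I_(farity f) -> E) : exists y, rfun N z y.
Proof.
set k := farity f.
have : valid (Ex (Eq (App f (vars k 1)) (Var 0))).
  move=> D M e; apply/sat_Ex.
  exists (funS M (fun i => teval M e (vars k 0 i))).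
  by apply: funS_congr => i; rewrite !ffunE; apply: eqS_refl.
move/rsat_valid/(_ (fcat z tl0)) => /= h; apply: NNPP => no; apply: h => y.
rewrite rargs_vars => h; apply: no; exists y.
by move: h; rewrite (_ : (fun i => _) = z) // -[RHS](fcat0 z tl0).
Qed.

Let fun_uniq f (z : 'I_(farity f) -> E) x y : rfun N z x ->
  rfun N z y <-> req N x y.
Proof.
set k := farity f => zx; set t := App f (vars k 0).
have h1 : valid (Imp (Eq t (Var (k + 0)))
    (Imp (Eq t (Var (k + 1))) (Eq (Var (k + 0)) (Var (k + 1))))).
  by move=> D M e /= h; apply/eqS_trans/eqS_sym.
have h2 : valid (Imp (Eq t (Var (k + 0)))
    (Imp (Eq (Var (k + 0)) (Var (k + 1))) (Eq t (Var (k + 1))))).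
  by move=> D M e /=; apply: eqS_trans.
have := rsat_valid h2 (fcat z (scons x (scons y tl0))).
have := rsat_valid h1 (fcat z (scons x (scons y tl0))).
by rewrite /= !rargs_vars !fcat0 !fcat_addn /=; split; auto.
Qed.

(** Equivalence, congruence, totality and uniqueness are instances of valid formulas, read
    relationally. Choice then selects a value for each symbol and arguments, and extensionality
    identifies its graph with the given relation. *)
Lemma rel_structure_functional : exists M : structure S E, graph M = N.
Proof.
have /functional_choice[F hF] (x : {f : funsym S & 'I_(farity f) -> E}) :
    exists y, rfun N (projT2 x) y by apply: fun_total.
pose fn f z := F (existT (fun f => 'I_(farity f) -> E) f z).
have fnE f (z : 'I_(farity f) -> E) y : rfun N z y <-> req N (fn f z) y.
  exact: (fun_uniq y (hF (existT _ f z))).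
have fn_congr f (z w : 'I_(farity f) -> E) :
    (forall i, req N (z i) (w i)) -> req N (fn f z) (fn f w).
  by move=> zw; apply/fnE/(fun_congr (fun i => sym (zw i)))/fnE.
exists (@Structure S E (req N) (@rrel _ _ N) fn refl sym trans rel_congr fn_congr).
rewrite /graph /=; case: N fnE => R1 R2 R3 /= fnE; congr RelStructure.
do 3 (apply: functional_extensionality_dep => ?).
by apply: propositional_extensionality; rewrite fnE.
Qed.

End Functional.

(** * Composition of translations *)

Lemma flatten_flatten_map A B D (g : A -> seq B) (h : D -> seq A) l :
  flatten [seq flatten (map g (h i)) | i <- l] = flatten (map g (flatten (map h l))).
Proof. by elim: l => //= i l ->; rewrite map_cat flatten_cat. Qed.

Lemma sumn_flatten_map A D (g : A -> nat) (h : D -> seq A) l :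
  sumn [seq sumn (map g (h i)) | i <- l] = sumn (map g (flatten (map h l))).
Proof. by elim: l => //= i l ->; rewrite map_cat sumn_cat. Qed.

Section PieceEnv.
Variables (T Q : signature) (tau : translation T Q).
Implicit Types (ps : seq (piece tau)).

Definition dims ps : seq nat := [seq dim p | p <- ps].

(** The free variables of a defining formula are rendered by consecutive blocks, one for each listed
    piece. *)
Definition pieces_env ps : env tau := fun n =>
  (nth ord0 ps n, iota (sumn (dims (take n ps))) (dim (nth ord0 ps n))).

Lemma dims_offset n ps : n < size ps ->
  sumn (dims (take n ps)) + dim (nth ord0 ps n) <= sumn (dims ps).
Proof.
move=> lt_n; rewrite -[X in _ <= sumn (dims X)](cat_take_drop n) /dims map_cat.
by rewrite sumn_cat leq_add2l (drop_nth ord0) //= leq_addr.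
Qed.

Lemma pieces_env_ok ps : env_ok (size ps) (sumn (dims ps)) (pieces_env ps).
Proof.
move=> n lt_n; rewrite /block_ok /= size_iota eqxx /=; apply/allP => x.
by rewrite mem_iota => /andP[_ lt_x]; apply: leq_trans lt_x (dims_offset lt_n).
Qed.

Lemma tr_pieces_bounded ps n m p : bounded n p -> size ps = n ->
  sumn (dims ps) = m -> bounded m (tr (pieces_env ps) p).
Proof. by move=> hp sz <-; apply: tr_bounded hp _; rewrite -sz; apply: pieces_env_ok. Qed.

Variables (D : Type) (M : structure Q D) (d0 : D).
Local Notation elt := (internal_elt tau M d0).
Implicit Types (w : elt) (ws : seq elt).

Definition eltp w := (sval w).1.
Definition elts w := (sval w).2.

Lemma size_elts w : size (elts w) = dim (eltp w).
Proof. by case: w => b []. Qed.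

Definition spread ws : seq D := flatten [seq elts w | w <- ws].

Lemma size_spread ws : size (spread ws) = sumn (dims [seq eltp w | w <- ws]).
Proof.
rewrite size_flatten /shape /dims -!map_comp; congr sumn.
by apply: eq_map => w /=; rewrite size_elts.
Qed.

Lemma pieces_env_rep ps xs ws (w0 : elt) :
  ps = [seq eltp w | w <- ws] -> xs = spread ws ->
  env_rep (fun b x => b = sval x) (size ws) (nth d0 xs) (pieces_env ps) (nth w0 ws).
Proof.
move=> -> -> n lt_n; rewrite /block_value /pieces_env /=.
rewrite (nth_map w0) // [RHS]surjective_pairing; congr pair.
have el : elts (nth w0 ws n) = nth [::] [seq elts w | w <- ws] n.
  by rewrite (nth_map w0).
have := @map_nth_slice _ d0 [seq elts w | w <- ws] n.
rewrite size_map -el size_elts => /(_ lt_n) E.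
apply: etrans _ E; congr map; congr (iota (sumn _) _).
rewrite /dims /shape -!map_take -!map_comp; apply: eq_map => w /=.
by rewrite size_elts.
Qed.

(** Converse to [pieces_env_rep]: cutting [xs] at the dimensions of [ps] gives tuples that are
    elements, and flattening them restores [xs]. *)
Lemma pieces_values ps xs (w0 : elt) : size xs = sumn (dims ps) ->
  (forall n, n < size ps ->
     exists w, block_value (nth d0 xs) (pieces_env ps n) = sval w) ->
  exists2 ws, ps = [seq eltp w | w <- ws] & xs = spread ws.
Proof.
move=> sz H; have /functional_choice[w hw] (n : 'I_(size ps)) :
    exists w, block_value (nth d0 xs) (pieces_env ps n) = sval w by apply: H.
pose ws := [seq w n | n <- enum 'I_(size ps)].
have ws_n (n : 'I_(size ps)) : nth w0 ws n = w n.
  by rewrite (nth_map n) ?nth_ord_enum // size_enum_ord.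
have sz_ws : size ws = size ps by rewrite size_map size_enum_ord.
exists ws.
  apply: (@eq_from_nth _ ord0); first by rewrite size_map sz_ws.
  move=> n lt_n; rewrite (nth_map w0) ?sz_ws // (ws_n (Ordinal lt_n)).
  by rewrite /eltp -hw.
rewrite /spread -[LHS](@reshapeKr _ (dims ps)) ?sz //; congr flatten.
apply: (@eq_from_nth _ [::]); first by rewrite size_reshape [LHS]size_map [RHS]size_map sz_ws.
move=> n; rewrite size_reshape size_map => lt_n.
rewrite (nth_map w0) ?sz_ws // (ws_n (Ordinal lt_n)) /elts -hw /=.
rewrite nth_reshape /dims (nth_map ord0) // -map_take map_nth_iota //.
by rewrite sz leq_subRL ?dims_offset // (leq_trans _ (dims_offset lt_n)) ?leq_addr.
Qed.

Lemma sat_pieces (N : structure T elt) ps xs ws w0 n p :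
  graph N = internal tau M d0 -> bounded n p -> size ws = n ->
  ps = [seq eltp w | w <- ws] -> xs = spread ws ->
  sat M (nth d0 xs) (tr (pieces_env ps) p) <-> sat N (nth w0 ws) p.
Proof.
move=> gN hp sz eps exs; rewrite -(rsat_graph N) gN.
apply: (sat_tr (internal_representation tau M d0) hp).
by rewrite -sz; apply: pieces_env_rep.
Qed.

End PieceEnv.

Section Composition.
Variables (S T Q : signature) (rho : translation S T) (tau : translation T Q).

(* A piece of the composite is a piece [i] of rho with a piece of tau for each of
   the [dim i] coordinates. *)
Definition comp_piece : finType := {i : piece rho & (dim i).-tuple (piece tau)}.

Definition comp_piece0 : comp_piece :=
  existT _ ord0 [tuple of nseq (dim (ord0 : piece rho)) ord0].

(** Pieces of a translation are ordinals, so composite pieces are numbered through their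
    enumeration; [.-1.+1] puts the cardinal into the successor form required there. *)
Definition decode (I : 'I_#|comp_piece|.-1.+1) : comp_piece :=
  nth comp_piece0 (enum comp_piece) I.

Lemma decode_onto (c : comp_piece) : exists I, decode I = c.
Proof.
have lt_c : index c (enum comp_piece) < #|comp_piece|.
  by rewrite cardE index_mem mem_enum.
have lt_c' : index c (enum comp_piece) < #|comp_piece|.-1.+1.
  exact: leq_trans lt_c (leqSpred _).
by exists (Ordinal lt_c'); rewrite /decode nth_index ?mem_enum.
Qed.

Definition outer I : piece rho := tag (decode I).
Definition inner I : seq (piece tau) := val (tagged (decode I)).

Lemma size_inner I : size (inner I) = dim (outer I).
Proof. exact: size_tuple. Qed.

Definition comp_dim I := sumn (dims (inner I)).

(** The first conjunct makes each block an element for [tau]; the second asks those elements to lie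
    in the domain of [rho]. *)
Definition comp_dom I := And
  (\big[@And Q/@Top Q]_(n < size (inner I)) dom_at (pieces_env (inner I) n))
  (tr (pieces_env (inner I)) (dom (outer I))).

Definition comp_eqt I J := tr (pieces_env (inner I ++ inner J)) (eqt (outer I) (outer J)).

Definition inners n (K : 'I_n -> 'I_#|comp_piece|.-1.+1) :=
  flatten [seq inner (K i) | i <- enum 'I_n].

Definition comp_relt (r : relsym S) (K : {ffun 'I_(rarity r) -> 'I_#|comp_piece|.-1.+1}) :=
  tr (pieces_env (inners K)) (relt [ffun i => outer (K i)]).

Definition comp_funt (f : funsym S) (K : {ffun 'I_(farity f) -> 'I_#|comp_piece|.-1.+1}) J :=
  tr (pieces_env (inners K ++ inner J)) (funt [ffun i => outer (K i)] (outer J)).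

Lemma size_inners n (K : 'I_n -> 'I_#|comp_piece|.-1.+1) :
  size (inners K) = \sum_i dim (outer (K i)).
Proof.
rewrite size_flatten /shape -map_comp sumnE big_map big_enum /=.
by apply: eq_bigr => i _; rewrite size_inner.
Qed.

Lemma dims_inners n (K : 'I_n -> 'I_#|comp_piece|.-1.+1) :
  sumn (dims (inners K)) = \sum_i comp_dim (K i).
Proof. by rewrite /dims -sumn_flatten_map sumnE big_map big_enum. Qed.

Lemma comp_domP I : bounded (comp_dim I) (comp_dom I).
Proof.
rewrite /comp_dom /= !andbT; apply/andP; split.
  apply: big_and_bounded => n.
  have /andP[/eqP sz h] := pieces_env_ok (ltn_ord n).
  by apply: at_vars_bounded h _; rewrite sz domP.
exact: tr_pieces_bounded (domP _) (size_inner I) _.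
Qed.

Lemma comp_eqtP I J : bounded (comp_dim I + comp_dim J) (comp_eqt I J).
Proof.
apply: tr_pieces_bounded (eqtP _ _) _ _; first by rewrite size_cat !size_inner.
by rewrite /dims map_cat sumn_cat.
Qed.

Lemma comp_reltP (r : relsym S)
    (K : {ffun 'I_(rarity r) -> 'I_#|comp_piece|.-1.+1}) :
  bounded (\sum_i comp_dim (K i)) (comp_relt K).
Proof.
apply: tr_pieces_bounded (reltP _) _ (dims_inners K); rewrite size_inners.
by apply: eq_bigr => i _; rewrite ffunE.
Qed.

Lemma comp_funtP (f : funsym S)
    (K : {ffun 'I_(farity f) -> 'I_#|comp_piece|.-1.+1}) J :
  bounded (\sum_i comp_dim (K i) + comp_dim J) (comp_funt K J).
Proof.
apply: tr_pieces_bounded (funtP _ _) _ _; last first.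
  by rewrite /dims map_cat sumn_cat dims_inners.
rewrite size_cat size_inner size_inners; congr (_ + _).
by apply: eq_bigr => i _; rewrite ffunE.
Qed.

Definition comp_translation : translation S Q :=
  Translation comp_domP comp_eqtP comp_reltP comp_funtP.

Variables (D : Type) (M : structure Q D) (d0 : D).
Variables (N : structure T (internal_elt tau M d0)) (w0 : internal_elt tau M d0).
Hypothesis graphN : graph N = internal tau M d0.

(** An element of the internal model for [rho] inside [N] is a tuple of tuples over [M]; flattening
    it gives its representative in the composite. *)
Definition comp_rep (b : piece comp_translation * seq D) (x : internal_elt rho N w0) :=
  [/\ outer b.1 = eltp x, inner b.1 = [seq eltp w | w <- elts x] &
      b.2 = spread (elts x)].

Lemma comp_representation :
  representation M (internal rho N w0) d0 comp_rep.
Proof.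
have size_args n (z : 'I_n -> internal_elt rho N w0) :
    size (args_values (fun i => sval (z i))) =
    \sum_i dim ([ffun i => eltp (z i)] i).
  rewrite size_flatten /shape -map_comp sumnE big_map big_enum /=.
  by apply: eq_bigr => i _; rewrite ffunE -size_elts.
have inners_args n (b : 'I_n -> piece comp_translation * seq D) z :
    (forall i, comp_rep (b i) (z i)) -> inners [ffun i => (b i).1] =
    [seq eltp w | w <- args_values (fun i => sval (z i))].
  move=> hb; rewrite map_flatten -map_comp; congr flatten.
  by apply: eq_map => i; rewrite ffunE; case: (hb i).
have values_args n (b : 'I_n -> piece comp_translation * seq D) z :
    (forall i, comp_rep (b i) (z i)) ->
    args_values b = spread (args_values (fun i => sval (z i))).
  move=> hb; rewrite /spread -flatten_flatten_map; congr flatten.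
  by apply: eq_map => i; case: (hb i).
split.
- by move=> b x [_ hi ->]; rewrite size_spread -hi.
- move=> x; have sz := size_elts x.
  have sz' : size [seq eltp w | w <- elts x] == dim (eltp x) by rewrite size_map sz.
  have [I hI] := decode_onto (existT _ (eltp x) (Tuple sz')).
  by exists (I, spread (elts x)); split; rewrite /= /outer /inner ?hI.
- move=> [I xs] sz; rewrite -[sat _ _ _]/(sat M (nth d0 xs) (comp_dom I)).
  rewrite /comp_dom sat_And sat_big_And; split.
    case=> hd ht.
    (* The first conjunct cuts [xs] into elements of [N]; the second then becomes the domain formula
       of [rho] in [N]. *)
    have [n lt_n|ws hws hxs] := @pieces_values _ _ tau _ M d0 (inner I) xs w0 sz.
      have := hd (Ordinal lt_n).
      rewrite (sat_dom_at (internal_representation tau M d0)) /= ?size_iota //.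
    have szw : size ws = dim (outer I) by rewrite -size_inner hws size_map.
    have hN : sat N (nth w0 ws) (dom (outer I)).
      exact: (proj1 (sat_pieces w0 graphN (domP _) szw hws hxs)) ht.
    by exists (exist _ (outer I, ws) (conj szw hN)); split.
  case=> x [/= ho hi hxs]; split.
    move=> n; rewrite (sat_dom_at (internal_representation tau M d0)) ?size_iota //.
    have lt_n : n < size (elts x) by rewrite -(size_map (@eltp _ _ _ _ _ _)) -hi.
    by exists (nth w0 (elts x) n); apply: pieces_env_rep.
  case: x ho hi hxs => -[i ws] [/= szw hN] ho hi hxs; rewrite ho.
  exact: (proj2 (sat_pieces w0 graphN (domP _) szw hi hxs)).
- move=> [I xs] [J ys] x y [/= oI iI ->] [/= oJ iJ ->].
  rewrite /comp_eqt oI oJ; apply: (sat_pieces w0 graphN (eqtP _ _)).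
  + by rewrite size_cat !size_elts.
  + by rewrite map_cat iI iJ.
  + by rewrite /spread map_cat flatten_cat.
- move=> r b z hb; rewrite /= /comp_relt.
  rewrite (_ : [ffun i => outer _] = [ffun i => eltp (z i)]); last first.
    by apply/ffunP => i; rewrite !ffunE; case: (hb i).
  apply: (sat_pieces w0 graphN (reltP _)).
  + exact: size_args.
  + exact: inners_args.
  + exact: values_args.
- move=> f b [J ys] z y hb [/= oJ iJ ->]; rewrite /comp_funt oJ.
  rewrite (_ : [ffun i => outer _] = [ffun i => eltp (z i)]); last first.
    by apply/ffunP => i; rewrite !ffunE; case: (hb i).
  apply: (sat_pieces w0 graphN (funtP _ _)).
  + by rewrite size_cat size_args size_elts.
  + by rewrite map_cat iJ (inners_args _ _ _ hb).
  + by rewrite (values_args _ _ _ hb) /spread map_cat flatten_cat.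
Qed.

End Composition.

(** * Models of theories and transitivity of interpretability *)

Definition models (U : theory) D (M : structure (tsig U) D) : Prop :=
  forall q, tax q -> forall e, sat M e (sform q).

Lemma provable_sat U p D (M : structure (tsig U) D) e :
  provable U p -> models M -> sat M e p.
Proof.
move=> [G [GU Gp]] MU; apply: (soundness Gp) => r hr.
by case: (In_mapP hr) => q hq ->; apply/MU/GU.
Qed.

Lemma sat_provable (U : theory) (L : seq (sentence (tsig U))) p :
  (forall q, List.In q L -> tax q) ->
  (forall D (M : structure (tsig U) D) e,
     (forall q, List.In q L -> forall e', sat M e' (sform q)) -> sat M e (sform p)) ->
  provable U p.
Proof.
move=> LU h; exists L; split=> //; apply: completeness => D M e hM.
by apply: h => q hq e'; apply/(sat_sentence (e := e))/hM/In_map.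
Qed.

Lemma rsat_alls S E (N : rel_structure S E) eps d p xs :
  rsat N eps (alls d p) -> size xs = d -> rsat N (catv xs eps) p.
Proof.
elim: d xs eps => [|d IH] xs eps /= h; first by move/size0nil->; rewrite catv_nil.
case/lastP: xs => // xs x; rewrite size_rcons catv_rcons => -[].
by apply: IH; apply: h.
Qed.

Lemma provable_valid (U : theory) (p : sentence (tsig U)) : valid p -> provable U p.
Proof. by move=> vp; apply: (sat_provable (L := [::])) => // D M e _; apply: vp. Qed.

Lemma valid_nonempty S : valid (nonempty S).
Proof. by move=> D M e; apply; apply: (e 0). Qed.

(** Valid sentences are theorems of [W], so their translations hold in [M]; the internal structure
    thus satisfies all validities and is the graph of a structure. *)
Lemma interpretation_model (V W : theory) (tau : translation (tsig W) (tsig V))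
    D (M : structure (tsig V) D) (e : nat -> D) :
  is_interpretation tau -> models M ->
  exists (w0 : internal_elt tau M (e 0))
    (N : structure (tsig W) (internal_elt tau M (e 0))),
    graph N = internal tau M (e 0).
Proof.
move=> hI MV; have hM (p : sentence (tsig W)) : valid p -> sat M e (tr_sentence tau p).
  by move=> vp; apply: provable_sat MV; apply/hI/provable_valid.
have [w0] := internal_inhabited (e 0) (hM _ (@valid_nonempty _)).
exists w0; apply: (rel_structure_functional w0) => p vp eps.
have [n hn] := bounded_ex p.
(* Only sentences can be translated through [hM], so [p] is closed by [n] quantifiers; [eps] is
   recovered from its first [n] entries and its tail. *)
have vn : valid (alls n p) by move=> D' M' e'; apply/sat_alls => xs _; apply: vp.
have bn : bounded 0 (alls n p).
  by apply: alls_bounded; rewrite addn0.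
have := hM (Sentence bn) vn.
rewrite (sat_tr_sentence (internal_representation tau M (e 0)) e
  (fun k => eps (n + k))) => /rsat_alls/(_ (size_mkseq eps n)).
rewrite (_ : catv _ _ = eps) //; apply: functional_extensionality => k.
rewrite /catv size_mkseq; case: ltnP => [lt|le]; first by rewrite nth_mkseq.
by rewrite subnKC.
Qed.

(** A model [M] of [V] has an internal structure [N] for [tau], which has one for [rho];
    [comp_representation] reads the composite translation there. The finite list [L] is the context
    for completeness. *)
Theorem interprets_trans (V W Z : theory) (L : seq (sentence (tsig V))) :
  (forall q, tax q <-> List.In q L) ->
  interprets V W -> interprets W Z -> interprets V Z.
Proof.
move=> VL [tau htau] [rho hrho]; exists (comp_translation rho tau) => p Zp.
apply: (sat_provable (L := L)) => [q /VL //|D M e hM].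
have MV : models M by move=> q /VL; apply: hM.
have [w0 [N gN]] := interpretation_model e htau MV.
have hN q : provable Z q -> sat N (fun=> w0) (tr_sentence rho q).
  move=> Zq; rewrite -(rsat_graph N) gN.
  apply: (proj1 (sat_tr_sentence (internal_representation tau M (e 0)) e _ _)).
  by apply: provable_sat MV; apply/htau/hrho.
have [x] := internal_inhabited w0 (hN _ (provable_valid (@valid_nonempty _))).
apply: (proj2 (sat_tr_sentence (comp_representation rho w0 gN) e (fun=> x) p)).
apply: (proj1 (sat_tr_sentence (internal_representation rho N w0) (fun=> w0) _ p)).
exact: hN.
Qed.

(** * The diamond *)

Section Modal.
Variables (A : fin_theory) (C : fin_theory -> sentence (fsig A)).
Hypothesis hC : forall D : fin_theory, interpreter A D (C D).
Implicit Types (X E : sentence (fsig A)).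

Definition entails X E := forall D (M : structure (fsig A) D),
  models (U := A) M -> forall e, sat M e X -> sat M e E.

Lemma provable_extend X p : provable (extend (U := A) X) p <-> entails X p.
Proof.
split=> [h D M MA e hX|h].
  apply: (provable_sat (U := extend (U := A) X) e h) => q [/MA //|-> e'].
  exact: sat_sentence hX.
apply: (sat_provable (U := extend (U := A) X) (L := X :: fax A)).
  by move=> q [->|hq]; [right | left].
move=> D M e hM; apply: h; last by apply: hM; left.
by move=> q hq e'; apply: hM; right.
Qed.

Lemma provable_fin p : provable A p <-> entails (sneg sbot) p.
Proof.
split=> [h D M MA e _|h]; first exact: provable_sat h MA.
by apply: (sat_provable (U := A) (L := fax A)) => // D M e hM; apply: h.
Qed.

Lemma sat_fin_axiom D (M : structure (fsig A) D) e :
  sat M e (fin_axiom A) <-> models (U := A) M.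
Proof.
have -> : models (U := A) M <-> forall q, List.In q (fax A) -> sat M e (sform q).
  split=> h q hq => [|e']; first exact: h.
  exact: sat_sentence (h q hq).
rewrite /fin_axiom; elim: (fax A) => [|q l IH]; first by split=> // _ h; apply: h.
rewrite -[sat _ _ _]/(sat M e (And q (foldr (@sand _) (sneg sbot) l))) sat_And IH.
split=> [[hq hl] r /= [<-|/hl]//|h].
by split=> [|r hr]; apply: h; [left | right].
Qed.

Lemma provable_fin_and E p : provable (fin_and E) p <-> entails E p.
Proof.
have EE D (M : structure (fsig A) D) e :
    sat M e (sand (fin_axiom A) E) <-> models (U := A) M /\ sat M e E.
  by rewrite -(sat_fin_axiom M e) -sat_And.
split=> [h D M MA e hE|h].
  apply: (provable_sat (U := fin_and E) e h) => q [<- e'|//].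
  by apply/EE; split=> //; apply: sat_sentence hE.
apply: (sat_provable (U := fin_and E) (L := [:: sand (fin_axiom A) E])) => //.
move=> D M e hM.
have /EE[MA hE] : sat M e (sand (fin_axiom A) E) by apply: hM; left.
exact: h.
Qed.

Definition dia E := diamond (U := A) (A := A) C (id_translation (fsig A)) E.

Lemma sat_dia D (M : structure (fsig A) D) e E :
  sat M e (dia E) <-> sat M e (C (fin_and E)).
Proof. exact: sat_id_translation. Qed.

(** This is the defining property of the interpreter, since the identity translation preserves
    truth. *)
Lemma interprets_dia X E :
  interprets (extend (U := A) X) (fin_and E) <-> entails X (dia E).
Proof.
rewrite (hC (fin_and E) X) provable_extend.
by split=> h D M MA e hX; apply/sat_dia/h.
Qed.

Lemma interprets_iff X E : interprets (extend (U := A) X) (fin_and E) <->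
  exists tau : translation (fsig A) (fsig A),
    forall p, entails E p -> entails X (tr_sentence tau p).
Proof.
split=> -[tau h]; exists tau => p.
  by move/provable_fin_and/h/provable_extend.
by move/provable_fin_and => Ep; apply/provable_extend/h.
Qed.

(** Taking [X] to be [dia E] itself in [interprets_dia] yields the interpretation. *)
Lemma dia_unfold E : exists tau : translation (fsig A) (fsig A),
  forall p, entails E p -> entails (dia E) (tr_sentence tau p).
Proof. by apply/interprets_iff/interprets_dia => D M MA e. Qed.

(* An interpretation of [A + E] splits according to the truth of the translations
   of [E1] and [E2]. *)
Lemma dia_or E E1 E2 D (M : structure (fsig A) D) e :
  entails E (simp (sneg E1) E2) -> models (U := A) M ->
  sat M e (dia E) -> sat M e (dia E1) \/ sat M e (dia E2).
Proof.
move=> E12 MA hE; have [tau htau] := dia_unfold E.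
(* What [F] proves, [E] proves under the hypothesis [F]; so once the translation of [F] is assumed,
   the same [tau] interprets [A + F]. *)
have split_case F : sat M e (tr_sentence tau F) -> sat M e (dia F).
  move=> hF; have : entails (sand (dia E) (tr_sentence tau F)) (dia F).
    apply/interprets_dia/interprets_iff; exists tau => p Fp D' M' MA' e' /sat_And[h1 h2].
    have /htau/(_ _ _ MA' _ h1) /= : entails E (simp F p).
      by move=> D2 M2 MA2 e2 _ /=; apply: Fp.
    by apply.
  by apply=> //; apply/sat_And.
have := htau _ E12 _ _ MA _ hE; rewrite /= => h.
have [h1|h1] := classic (sat M e (tr_sentence tau E1)).
  by left; apply: split_case.
by right; apply/split_case/h.
Qed.

(** This is [dia_or] with both disjuncts equal to [F]. *)
Lemma dia_mono E F : entails E F -> entails (dia E) (dia F).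
Proof.
move=> EF D M MA e hE.
have [//|//] : sat M e (dia F) \/ sat M e (dia F).
by apply: dia_or hE => // D' M' MA' e' /= hE _; apply: EF hE.
Qed.

(** Translations send [Bot] to [Bot], so an interpretation of an inconsistent theory yields a
    contradiction. *)
Lemma dia_bot : entails (dia sbot) sbot.
Proof. by have [tau h] := dia_unfold sbot; apply: (h sbot). Qed.

Lemma dia_refl E : entails E (dia E).
Proof.
apply/interprets_dia/interprets_iff; exists (id_translation (fsig A)) => p Ep.
by move=> D M MA e hE; apply/sat_id_translation/Ep.
Qed.

Lemma dia_trans E : entails (dia (dia E)) (dia E).
Proof.
apply/interprets_dia; apply: (interprets_trans (V := extend (U := A) (dia (dia E)))
  (W := extend (U := A) (dia E))
  (L := dia (dia E) :: fax A)).
- by move=> q; split=> /= -[]; auto.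
- have [tau h] := dia_unfold (dia E); exists tau => p.
  by move/provable_extend/h/provable_extend.
- by apply/interprets_dia => D M MA e.
Qed.

(** By contraposition: the negation of [Q] entails that [P] or [simp P Q] fails, and [dia_or]
    distributes the diamond over the two cases. *)
Lemma box_K P Q D (M : structure (fsig A) D) e : models (U := A) M ->
  ~ sat M e (dia (sneg (simp P Q))) -> ~ sat M e (dia (sneg P)) ->
  ~ sat M e (dia (sneg Q)).
Proof.
move=> MA hPQ hP hQ.
have [//|//] : sat M e (dia (sneg P)) \/ sat M e (dia (sneg (simp P Q))).
by apply: dia_or MA hQ => D' M' MA' e' /=; tauto.
Qed.

Lemma dia_dual P D (M : structure (fsig A) D) e : models (U := A) M ->
  sat M e (dia P) <-> ~ ~ sat M e (dia (sneg (sneg P))).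
Proof.
move=> MA; split=> [h|/NNPP h].
  by apply; apply: dia_mono h => // D' M' MA' e' /= hP; apply.
by apply: dia_mono h => // D' M' MA' e' /NNPP.
Qed.

Lemma box_4 P D (M : structure (fsig A) D) e : models (U := A) M ->
  ~ sat M e (dia (sneg P)) ->
  ~ sat M e (dia (sneg (sneg (dia (sneg P))))).
Proof.
move=> MA h h'; apply/h/dia_trans/(dia_mono _ MA h') => // D' M' MA' e'.
exact: NNPP.
Qed.

End Modal.

Theorem theorem7p2 (A : fin_theory) (hA : Friedman_reflexive A)
    (C : fin_theory -> sentence (fsig A))
    (hC : forall D : fin_theory, interpreter A D (C D)) :
  forall p : modal,
    S4 p -> interpreter_logic A A C (id_translation (fsig A)) p.
Proof.
move=> p hp sigma; apply/provable_fin.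
(* The induction concerns all models of [A] at once, because necessitation applies its hypothesis in
   models other than the given one. *)
elim: hp => {p} [p q|p q r|p|p q|p|p|p|p|p q _ IHpq _ IHp|p _ IHp] D M MA e top.
- by move=> hp _.
- by move=> hpqr hpq hp; apply: hpqr (hpq hp).
- exact: NNPP.
- exact: (box_K hC MA).
- exact: (proj1 (dia_dual hC _ e MA)).
- exact: (proj2 (dia_dual hC _ e MA)).
- by move=> hp; apply: NNPP => np; apply/hp/(dia_refl hC).
- exact: (box_4 hC MA).
- exact: IHpq MA e top (IHp _ _ MA e top).
(* The negation of a theorem entails [Bot], so its diamond would imply [dia sbot]. *)
- move=> np; apply: (dia_bot hC MA (e := e)); apply: (dia_mono hC _ MA np).
  by move=> D' M' MA' e' /=; apply; apply: IHp.
Qed.
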